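(* Let $G=(V,E)$ be an undirected graph with $n$ nodes, given together with a tree decomposition of $G$ of width $k$. Then the algorithm described in the context runs in time $O(n\cdot|E|)$, outputs a set $S_o$ that power dominates $G$, and $|S_o|\le (k+1)\,\mathrm{Opt}(G)$.
   Context: Power domination: for $S\subseteq V$, $\mathcal{P}_S$ is obtained by (Rule 1) putting every node of $S$ and every neighbor of a node of $S$ into $\mathcal{P}_S$, and (Rule 2) repeatedly: if $v\in\mathcal{P}_S$ and all neighbors of $v$ except exactly one neighbor $w$ are in $\mathcal{P}_S$, insert $w$. $S$ power dominates $G$ if $\mathcal{P}_S=V$; $\mathrm{Opt}(G)$ is the minimum size of a set power dominating $G$. For $R\subseteq V$, $nbr(R)=\{v\in V\setminus R: v$ adjacent to some $u\in R\}$; $R$ is an $S$-strong region if $R\not\subseteq\mathcal{P}_{S\cup nbr(R)}$. A tree decomposition of $G$ is a pair $\langle\{X_i: i\in I\},T\rangle$ where $T$ is a tree on node set $I$, each $X_i\subseteq V$ (a bag), $\bigcup_i X_i=V$, every edge of $G$ has both ends in some bag, and whenever $j$ lies on the path from $i$ to $k$ in $T$ we have $X_i\cap X_k\subseteq X_j$; its width is $\max_i|X_i|-1$. Algorithm: root $T$ at some node $r$; let $d$ be the maximum distance from $r$ in $T$. Set $S=\emptyset$. For $\ell=d,d-1,\dots,0$, and for each $T$-node $q$ at distance $\ell$ from $r$ (in any order): let $Y_q$ be the union of the bags of the $T$-nodes in the subtree of $T$ rooted at $q$; if $Y_q$ is an $S$-strong region (for the current $S$), set $S\leftarrow S\cup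 X_q$. Output $S_o=S$.
   Formalization: The time bound O(n·|E|) is claimed for a random access machine under the conventions that the decomposition tree has O(n) nodes and n = O(|E|); without them it fails, e.g. for a graph with no edges or a huge tree. Correctness and the ratio need no such assumption. *)

(* Defs.v *)
From mathcomp Require Import all_boot.

Set Implicit Arguments.
Unset Strict Implicit.
Unset Printing Implicit Defensive.

Record sgraph (V : finType) := SGraph {
  adj :> rel V;
  adj_sym : symmetric adj;
  adj_irr : irreflexive adj
}.

Section PowerDomination.
Variables (V : finType) (G : sgraph V).
Implicit Types (S R A : {set V}) (v w : V).

Definition edges : {set {set V}} :=
  [set [set uv.1; uv.2] | uv : V * V & adj G uv.1 uv.2].

Definition neighbors v : {set V} := [set w | adj G v w].

Definition dominated S : {set V} := S :|: \bigcup_(v in S) neighbors v.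

Definition forced A : {set V} :=
  [set w | [exists v in A, neighbors v :\: A == [set w]]].

(* P_S.  The iterated map is monotone, because a node forced by A is, for    *)
(* A \subset B, either in B or forced by B; so fixset is its least fixpoint, *)
(* i.e. the closure of dominated S under Rule 2.                             *)
Definition observed S : {set V} :=
  fixset (fun A => dominated S :|: (A :|: forced A)).

Definition power_dominates S : bool := observed S == [set: V].

Definition Opt : nat := #|[arg min_(S < [set: V] | power_dominates S) #|S|]|.

Definition nbr R : {set V} := [set v | (v \notin R) && [exists u in R, adj G u v]].

Definition strong_region S R : bool := ~~ (R \subset observed (S :|: nbr R)).

End PowerDomination.

Section Trees.
Variables (I : finType) (T : sgraph I).
Implicit Types (i j k r q : I).

Definition is_tree : Prop :=
  (forall i j, connect T i j) /\ (forall c : seq I, ucycle T c -> size c <= 2).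

(* j lies on a simple path from i to k; such a path has fewer than #|I| edges. *)
Definition on_path i k j : bool :=
  [exists l : 'I_#|I|, [exists p : l.-tuple I,
    [&& path T i p, last i p == k, uniq (i :: p) & j \in i :: p]]].

(* Least length of a walk from r to q (#|I| if there is none). *)
Definition dist r q : nat :=
  find (fun l => [exists p : l.-tuple I, path T r p && (last r p == q)])
       (iota 0 #|I|).

Definition depth r : nat := \max_(q : I) dist r q.

Definition subtree r q : {set I} := [set i | on_path r i q].

End Trees.

Record tree_decomp (V : finType) (G : sgraph V) (I : finType) := TreeDecomp {
  td_tree : sgraph I;
  bag : I -> {set V};
  td_treeP : is_tree td_tree;
  bag_cover : \bigcup_(i : I) bag i = [set: V];
  bag_edge : forall u v, adj G u v -> exists i, (u \in bag i) && (v \in bag i);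
  bag_path : forall i k j,
    on_path td_tree i k j -> bag i :&: bag k \subset bag j
}.

Section Algorithm.
Variables (V : finType) (G : sgraph V) (I : finType) (D : tree_decomp G I).
Variable r : I.

(* Truncated to 0, instead of -1, when all bags are empty (i.e. V is empty). *)
Definition width : nat := (\max_(i : I) #|bag D i|).-1.

Definition Y (q : I) : {set V} := \bigcup_(i in subtree (td_tree D) r q) bag D i.

Definition alg_step (S : {set V}) (q : I) : {set V} :=
  if strong_region G S (Y q) then S :|: bag D q else S.

(* ord l lists the nodes at distance l from the root, in processing order. *)
Definition level_order (ord : nat -> seq I) : Prop :=
  forall l, perm_eq (ord l) (enum [set q | dist (td_tree D) r q == l]).

Definition algorithm (ord : nat -> seq I) : {set V} :=
  foldl (fun S l => foldl alg_step S (ord l)) set0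
        (rev (iota 0 (depth (td_tree D) r).+1)).

End Algorithm.

(* Running time is measured on a unit-cost random access machine with        *)
(* addition and truncated subtraction, programmed in a structured language.  *)
(* Memory is a family of registers and a family of arrays; a program         *)
(* mentions finitely many of them.                                           *)
Inductive cmd :=
| Const (x n : nat)            (* x := n            *)
| Add (x y z : nat)            (* x := y + z        *)
| Sub (x y z : nat)            (* x := y - z        *)
| Read (x a y : nat)           (* x := a[y]         *)
| Write (a x y : nat)          (* a[x] := y         *)
| Seq (c1 c2 : cmd)
| IfLt (x y : nat) (c1 c2 : cmd)
| WhileLt (x y : nat) (c : cmd).

Record memory := Memory { reg : nat -> nat; arr : nat -> nat -> nat }.

Definition set_reg (s : memory) (x v : nat) : memory :=
  Memory (fun x' => if x' == x then v else reg s x') (arr s).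

Definition set_arr (s : memory) (a i v : nat) : memory :=
  Memory (reg s)
    (fun a' i' => if (a' == a) && (i' == i) then v else arr s a' i').

(* exec c s t s' : started in s, the program c halts in s' after t steps. *)
Inductive exec : cmd -> memory -> nat -> memory -> Prop :=
| ExecConst s x n : exec (Const x n) s 1 (set_reg s x n)
| ExecAdd s x y z : exec (Add x y z) s 1 (set_reg s x (reg s y + reg s z))
| ExecSub s x y z : exec (Sub x y z) s 1 (set_reg s x (reg s y - reg s z))
| ExecRead s x a y : exec (Read x a y) s 1 (set_reg s x (arr s a (reg s y)))
| ExecWrite s a x y : exec (Write a x y) s 1 (set_arr s a (reg s x) (reg s y))
| ExecSeq c1 c2 s1 s2 s3 t1 t2 :
    exec c1 s1 t1 s2 -> exec c2 s2 t2 s3 -> exec (Seq c1 c2) s1 (t1 + t2) s3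
| ExecIfTrue x y c1 c2 s s' t :
    reg s x < reg s y -> exec c1 s t s' -> exec (IfLt x y c1 c2) s t.+1 s'
| ExecIfFalse x y c1 c2 s s' t :
    reg s y <= reg s x -> exec c2 s t s' -> exec (IfLt x y c1 c2) s t.+1 s'
| ExecWhileTrue x y c s1 s2 s3 t1 t2 :
    reg s1 x < reg s1 y -> exec c s1 t1 s2 -> exec (WhileLt x y c) s2 t2 s3 ->
    exec (WhileLt x y c) s1 (t1 + t2).+1 s3
| ExecWhileFalse x y c s :
    reg s y <= reg s x -> exec (WhileLt x y c) s 1 s.

(* A family of sets (P a) is presented by duplicate-free lists, in any order. *)
Definition lists_of (A B : finType) (P : A -> {set B}) (l : A -> seq B) : Prop :=
  forall a, uniq (l a) /\ l a =i P a.

(* Elements of a finite type are coded by their enum_rank, and a family of    *)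
(* lists by its concatenation flat_lists together with the offsets at which   *)
(* the successive lists start (offset #|A| is the total length).              *)
Definition flat_lists (A B : finType) (l : A -> seq B) : seq nat :=
  flatten [seq [seq nat_of_ord (enum_rank b) | b <- l a] | a <- enum A].

Definition offset (A B : finType) (l : A -> seq B) (i : nat) : nat :=
  sumn (take i [seq size (l a) | a <- enum A]).

Definition input_memory (V I : finType) (nbV : V -> seq V) (nbI : I -> seq I)
    (bags : I -> seq V) (r : I) : memory :=
  Memory
    (fun x => nth 0 [:: #|V|; #|I|; nat_of_ord (enum_rank r)] x)
    (fun a i => match a with
       | 0 => if i <= #|V| then offset nbV i else 0
       | 1 => nth 0 (flat_lists nbV) i
       | 2 => if i <= #|I| then offset nbI i else 0
       | 3 => nth 0 (flat_lists nbI) i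
       | 4 => if i <= #|I| then offset bags i else 0
       | 5 => nth 0 (flat_lists bags) i
       | _ => 0
       end).

(* The output set is read off array 6 as a characteristic vector. *)
Definition outputs (V : finType) (s : memory) (S : {set V}) : Prop :=
  forall v, arr s 6 (nat_of_ord (enum_rank v)) = (v \in S).

(* Main.v *)
Require Import Defs.
From mathcomp Require Import all_boot zify.

(* Approximation.  If X_q is contained in S and no child region of q is       *)
(* S-strong, then Y_q and all neighbors of Y_q are observed by S, because     *)
(* edges leaving Y_c for a child c of q start in X_q.  So processing q makes  *)
(* Y_q non-strong for good.  If U is a union of regions that are observed     *)
(* together with their neighbors, and an optimal solution S0 meets Y_q only   *)
(* inside U, then S with nbr(Y_q) observes all that S0 observes in Y_q, and   *)
(* Y_q is not S-strong.  Hence each strong region contains an element of S0   *)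
(* that lies in no earlier strong region, and each costs one bag.             *)
(*                                                                            *)
(* Running time.  Each of the O(n) tests takes time O(|E|): the observed set  *)
(* is computed with a worklist, keeping for every node the number of its      *)
(* unobserved neighbors and the sum of their codes, so that a forced node is  *)
(* read off the sum.  The regions are rows of a table, and each row is merged *)
(* into the row of the parent once.                                           *)

Set Implicit Arguments.
Unset Strict Implicit.
Unset Printing Implicit Defensive.


(** * Rooted trees *)

(** Approximation. A region [Y q] touches the rest of the graph only through the bag of [q]: an edge
    leaving it starts in that bag and in the bag of the parent ([Y_exit]). Therefore, once the bag
    of [q] is selected and the child regions are not strong, the current set observes [Y q] and all
    its neighbors without help from outside ([Y_observed], [Y_neighbors_observed]), and the elements
    of an optimal solution [S0] lying in [Y q] have nothing left to contribute. If a later region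
    contained only such exhausted elements of [S0], the derivation by which [S0] observes it could
    be replayed inside it, with everything outside replaced by its set of neighbors
    ([observed_region]), so it would not be strong. Each region found strong thus contains a fresh
    element of [S0] ([strong_region_new]) and costs one bag of at most k+1 nodes; [alg_invariant]
    does the bookkeeping. The region of the root is the whole graph and has no neighbors, so its not
    being strong at the end is power domination.

    Running time. One fixed program is verified in a logic of triples [run c s T Q] with time
    bounds. A strength test is linear in the nodes and arcs of G: forcing a node costs time
    proportional to its degree, and each node is forced at most once ([potential], [run_propagate]).
    With m tree nodes there are m tests ([run_process]), plus O(m^2) steps because the nodes of a
    level are found by scanning all tree nodes ([sum_levels]). The total is O(n |E|) when m is O(n)
    and n is O(|E|). *)

Section RootedTree.
Variables (I : finType) (T : sgraph I).
Hypothesis treeT : is_tree T.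
Implicit Types (x a b i q : I) (p : seq I).

Lemma last_rcons_belast x p : p != [::] -> p = rcons (behead (belast x p)) (last x p).
Proof. by case: p => // y p _ /=; rewrite lastI. Qed.

(** Otherwise a simple path from [a] to [b] closes up through [x] to a cycle of length at least 3.
    This is the only place where acyclicity is used directly. *)
Lemma neighbors_separated x a b p :
  T x a -> T x b -> path T a p -> last a p = b -> x \notin a :: p -> a = b.
Proof.
case: treeT => _ acyclic xa xb pathp lastp xp; apply/eqP/negPn/negP => nab.
move: lastp; case/shortenP: pathp => p' pathp' uniqp' subp' lastp'.
have: ucycle T (x :: a :: p').
  rewrite /ucycle /= xa rcons_path pathp' lastp' adj_sym xb /=.
  rewrite -/(uniq (a :: p')) uniqp' andbT.
  apply: contra xp; rewrite !inE => /orP[->//|/subp' ->]; exact: orbT.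
move/acyclic; case: p' lastp' {pathp' uniqp' subp'} => //= ab.
by rewrite ab eqxx in nab.
Qed.

(** If the first steps [a] and [b] differed, following [p1] to the common end and [p2] backwards
    would join them while avoiding [x], against [neighbors_separated]. *)
Lemma simple_path_unique x p1 p2 :
  path T x p1 -> uniq (x :: p1) -> path T x p2 -> uniq (x :: p2) ->
  last x p1 = last x p2 -> p1 = p2.
Proof.
elim: p1 x p2 => [|a p1 IH] x [|b p2] //=.
- by move=> _ _ _ /andP[+ _] e; rewrite e mem_last.
- by move=> _ /andP[+ _] _ _ e; rewrite -e mem_last.
move=> /andP[xa pp1] /andP[x1 u1] /andP[xb pp2] /andP[x2 u2] elast.
have rp2 : path T (last a p1) (rev (belast b p2)).
  rewrite elast rev_path; rewrite (eq_path (e' := T)) // => y z.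
  exact: adj_sym.
suff ab : a = b by subst b; congr cons; exact: IH elast.
apply: (@neighbors_separated x a b (p1 ++ rev (belast b p2))) => //.
- by rewrite cat_path pp1.
- rewrite last_cat elast; case: (p2) => //= c p3.
  by rewrite rev_cons last_rcons.
- rewrite -cat_cons mem_cat negb_or x1 mem_rev /=.
  by apply: contra x2; exact: mem_belast.
Qed.

Lemma simple_path_exists x y :
  exists p, [&& path T x p, uniq (x :: p) & last x p == y].
Proof.
have /connectP[p pathp ->] := treeT.1 x y.
by case/shortenP: pathp => p' pp' up' _; exists p'; rewrite pp' up' eqxx.
Qed.

Definition tree_path x y : seq I := xchoose (simple_path_exists x y).

Lemma tree_pathP x y :
  [/\ path T x (tree_path x y), uniq (x :: tree_path x y)
    & last x (tree_path x y) = y].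
Proof. by have /and3P[? ? /eqP ?] := xchooseP (simple_path_exists x y). Qed.

Lemma tree_path_eq x p :
  path T x p -> uniq (x :: p) -> tree_path x (last x p) = p.
Proof.
move=> pp up; have [pt ut et] := tree_pathP x (last x p).
exact: (simple_path_unique pt ut pp up).
Qed.

Lemma size_simple_path x p : uniq (x :: p) -> size p < #|I|.
Proof. by move/card_uniqP=> /= e; rewrite -e max_card. Qed.

Lemma on_pathP i k j :
  reflect (exists p, [/\ path T i p, last i p = k, uniq (i :: p) & j \in i :: p])
          (on_path T i k j).
Proof.
apply: (iffP existsP) => [[l /existsP[p /and4P[? /eqP ? ? ?]]]|[p [pp lp up jp]]].
  by exists p.
have lt := size_simple_path up; exists (Ordinal lt); apply/existsP.
by exists (in_tuple p); rewrite pp lp up jp eqxx.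
Qed.

Lemma on_path_tree i k j : on_path T i k j = (j \in i :: tree_path i k).
Proof.
apply/on_pathP/idP => [[p [pp <- up jp]]|jp].
  by rewrite tree_path_eq.
by exists (tree_path i k); have [] := tree_pathP i k.
Qed.

Lemma dist_tree_path x y : dist T x y = size (tree_path x y).
Proof.
have [pt ut et] := tree_pathP x y.
rewrite /dist; set w := (X in find X _); have lt := size_simple_path ut.
have wt : w (size (tree_path x y)).
  by apply/existsP; exists (in_tuple (tree_path x y)); rewrite pt et eqxx.
have hasw : has w (iota 0 #|I|).
  by apply/hasP; exists (size (tree_path x y)); rewrite ?mem_iota.
apply/eqP; rewrite eqn_leq; apply/andP; split.
  rewrite leqNgt; apply/negP => /(before_find 0); rewrite nth_iota // add0n.
  by rewrite wt.
have := nth_find 0 hasw; move: hasw; rewrite has_find size_iota => dlt.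
rewrite nth_iota // add0n => /existsP[p /andP[pp /eqP lp]].
have := size_tuple p; move: (tval p) pp lp => {}p pp <- /=.
move=> {wt dlt et} <-.
(* Any walk shortens to a simple path, which is the tree path by uniqueness. *)
case/shortenP: pp => p' pp' up' subp'; rewrite tree_path_eq //.
by apply: uniq_leq_size => //; case/andP: up'.
Qed.

Variable r : I.
Local Notation pth := (tree_path r).

Lemma dist_lt q : dist T r q < #|I|.
Proof.
by rewrite dist_tree_path; have [_ /size_simple_path] := tree_pathP r q.
Qed.

Lemma subtreeE q i : (i \in subtree T r q) = (q \in r :: pth i).
Proof. by rewrite inE on_path_tree. Qed.

Lemma tree_path_root : pth r = [::].
Proof. by rewrite -[X in tree_path _ X]/(last r [::]) tree_path_eq. Qed.

Lemma tree_path_adj a b : T a b -> pth b = rcons (pth a) b \/ pth a = rcons (pth b) a.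
Proof.
move=> ab; have [pa ua ea] := tree_pathP r a.
case: (boolP (b \in r :: pth a)) => [bp|bp]; last first.
  left; rewrite -[X in tree_path _ X](last_rcons r (pth a) b) tree_path_eq //.
    by rewrite rcons_path pa ea.
  by rewrite -rcons_cons rcons_uniq bp.
right; case/splitPl: bp pa ua ea => p1 p2 ep1.
rewrite cat_path -cat_cons cat_uniq last_cat ep1 => /andP[pp1 pp2] /and3P[u1 dis u2] lp2.
have eb : pth b = p1 by rewrite -ep1 tree_path_eq.
have nab : b != a by apply: contraTneq ab => ->; rewrite adj_irr.
have p2n : p2 != [::] by case: (p2) lp2 nab => //= ->; rewrite eqxx.
have ain : a \in p2 by rewrite -lp2; case: (p2) p2n => //= c p3 _; exact: mem_last.
have anot : a \notin r :: p1.
  by apply/negP => h; move/negP: dis; case; apply/hasP; exists a.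
have <- : pth a = p1 ++ p2.
  rewrite -lp2 -ep1 -last_cat tree_path_eq //; first by rewrite cat_path pp1 ep1.
  by rewrite -cat_cons cat_uniq u1 dis.
rewrite eb -[X in tree_path _ X](last_rcons r p1 a) tree_path_eq //.
  by rewrite rcons_path pp1 ep1 adj_sym.
by rewrite -rcons_cons rcons_uniq anot.
Qed.

(** The inner list is the tree path from [r] to [q] without its final node; the default of [last]
    gives [r] both for the children of the root and for the root itself. *)
Definition parent q : I := last r (behead (belast r (pth q))).

Lemma tree_path_parent q : q != r -> pth q = rcons (pth (parent q)) q /\ T (parent q) q.
Proof.
move=> qr; have [pq uq eq] := tree_pathP r q.
have n0 : pth q != [::] by case: (pth q) eq => //= e; rewrite e eqxx in qr.
have := last_rcons_belast r n0; rewrite eq /parent; set p := behead _ => e.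
move: pq uq; rewrite e rcons_path -rcons_cons rcons_uniq => /andP[pp pT] /andP[_ up].
by rewrite tree_path_eq.
Qed.

Lemma parent_adj a b : T a b -> (b != r /\ parent b = a) \/ (a != r /\ parent a = b).
Proof.
move=> ab; have par c d : pth d = rcons (pth c) d -> d != r /\ parent d = c.
  move=> e; have dr : d != r.
    apply/eqP => d_r; move: e; rewrite d_r tree_path_root.
    by move/(congr1 size); rewrite size_rcons.
  split=> //; have [e' _] := tree_path_parent dr.
  move: e; rewrite e' => /rcons_inj [e1].
  by have [_ _ <-] := tree_pathP r (parent d); rewrite e1; have [_ _ ->] := tree_pathP r c.
by case: (tree_path_adj ab) => /par; [left|right].
Qed.

Lemma dist_parent q : q != r -> dist T r q = (dist T r (parent q)).+1.
Proof. by move/tree_path_parent=> [e _]; rewrite !dist_tree_path e size_rcons. Qed.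

Lemma dist_root : dist T r r = 0.
Proof. by rewrite dist_tree_path tree_path_root. Qed.

Lemma dist_eq0 q : (dist T r q == 0) = (q == r).
Proof.
by case: (eqVneq q r) => [->|/dist_parent ->//]; rewrite dist_root.
Qed.

Lemma subtree_root i : i \in subtree T r r.
Proof. by rewrite subtreeE mem_head. Qed.

Lemma subtree_refl q : q \in subtree T r q.
Proof. by rewrite subtreeE; have [_ _ {1}<-] := tree_pathP r q; exact: mem_last. Qed.

Lemma rooted_tree_ind (P : I -> Prop) :
  P r -> (forall i, i != r -> P (parent i) -> P i) -> forall i, P i.
Proof.
move=> Pr Ps i; elim: {i}(dist T r i) {-2}i (leqnn (dist T r i)) => [|n IH] i.
  by rewrite leqn0 dist_eq0 => /eqP ->.
case: (eqVneq i r) => [->//|ir]; rewrite dist_parent // ltnS => /IH.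
exact: Ps.
Qed.

Lemma subtree_of_root q : r \in subtree T r q -> q = r.
Proof. by rewrite subtreeE tree_path_root inE => /eqP. Qed.

Lemma subtree_step q i :
  i != r -> (i \in subtree T r q) = (i == q) || (parent i \in subtree T r q).
Proof.
move=> ir; have [e _] := tree_path_parent ir.
by rewrite !subtreeE e -rcons_cons mem_rcons in_cons eq_sym.
Qed.

Lemma subtree_parent c i : c != r -> i \in subtree T r c -> i \in subtree T r (parent c).
Proof.
move=> cr; elim/rooted_tree_ind: i => [/subtree_of_root e|i ir IH].
  by rewrite e eqxx in cr.
rewrite !(subtree_step _ ir) => /orP[/eqP ->|/IH ->]; last exact: orbT.
by rewrite subtree_refl orbT.
Qed.

Lemma subtree_child q i : i \in subtree T r q -> i != q ->
  exists c, [/\ c != r, parent c = q & i \in subtree T r c].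
Proof.
elim/rooted_tree_ind: i => [/subtree_of_root ->|i ir IH]; first by rewrite eqxx.
rewrite (subtree_step _ ir) => /orP[->//|iq niq].
case: (eqVneq (parent i) q) => [pq|npq].
  by exists i; split=> //; exact: subtree_refl.
have [c [cr pc ic]] := IH iq npq.
by exists c; split=> //; rewrite (subtree_step _ ir) ic orbT.
Qed.

(** By [parent_adj] every edge joins a node to its parent, and passing to the parent removes just
    one node from the path to the root; membership in the subtree is lost only if that node is
    [q]. *)
Lemma subtree_exit q a b :
  T a b -> a \in subtree T r q -> b \notin subtree T r q ->
  [/\ a = q, q != r & b = parent q].
Proof.
move=> ab; rewrite !subtreeE; case: (parent_adj ab) => [[br pb]|[ar pa]].
  have [-> _] := tree_path_parent br; rewrite pb -rcons_cons mem_rcons => h.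
  by rewrite inE h orbT.
have [-> _] := tree_path_parent ar; rewrite pa -rcons_cons mem_rcons inE.
by case: eqP => [-> //|/= _ ->].
Qed.

(** The first edge of the path that leaves the subtree is the edge from [q] to its parent. *)
Lemma on_path_exit q i k :
  i \in subtree T r q -> k \notin subtree T r q ->
  [/\ q != r, on_path T i k q & on_path T i k (parent q)].
Proof.
move=> iq kq; have [pp up ep] := tree_pathP i k.
suff [qr h1 h2] : [/\ q != r, q \in i :: tree_path i k & parent q \in i :: tree_path i k].
  by split=> //; rewrite on_path_tree.
move: (tree_path i k) pp ep {up} => p pp ep; move: ep kq iq pp => <-.
elim: p i => [|j p IH] i /=; first by move=> /negPf ->.
case/boolP: (j \in subtree T r q) => [jq lq _ /andP[_ pp]|jq lq iq /andP[ij pp]].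
  by have [-> h1 h2] := IH j lq jq pp; split=> //; rewrite inE ?h1 ?h2 orbT.
have [-> qr ->] := subtree_exit ij iq jq.
by split=> //; rewrite !inE eqxx ?orbT.
Qed.

End RootedTree.


(** * Observed sets *)

Section Observed.
Variables (V : finType) (G : sgraph V).
Implicit Types (S A B R : {set V}) (u v w : V).

Lemma dominatedP S v :
  reflect (v \in S \/ exists2 u, u \in S & G u v) (v \in dominated G S).
Proof.
rewrite inE; apply: (iffP orP) => -[vS|h]; [by left|right|by left|right].
  by have /bigcupP[u uS] := h; rewrite inE; exists u.
by have [u uS uv] := h; apply/bigcupP; exists u; rewrite ?inE.
Qed.

Lemma forcedP A w :
  reflect (exists v, [/\ v \in A, G v w, w \notin A
                       & forall u, G v u -> u != w -> u \in A])
          (w \in forced G A).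
Proof.
rewrite inE; apply: (iffP existsP) => [[v /andP[vA /eqP e]]|[v [vA vw wA vu]]].
  have /setP ee := e; have := ee w; rewrite !inE eqxx => /andP[wA vw].
  exists v; split=> // u vu uw; have := ee u.
  by rewrite !inE vu andbT (negPf uw) => /negbFE.
exists v; rewrite vA; apply/eqP/setP => u; rewrite !inE.
case: eqP => [->|/eqP uw]; first by rewrite wA vw.
by apply/negP => /andP[uA /vu /(_ uw)]; apply/negP.
Qed.

Let F S A := dominated G S :|: (A :|: forced G A).

Let F_mono S : {homo F S : A B / A \subset B}.
Proof.
move=> A B /subsetP sAB; apply/subsetP => w; rewrite /F !in_setU.
case/or3P => [->//|/sAB ->|]; first by rewrite orbT.
case: (boolP (w \in B)) => [|wB]; first by rewrite orbT.
case/forcedP => v [vA vw wA vu]; apply/or3P/Or33/forcedP.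
by exists v; split=> // [|u vu' uw]; apply: sAB => //; exact: vu.
Qed.

Lemma observed_fixed S :
  dominated G S :|: (observed G S :|: forced G (observed G S)) = observed G S.
Proof. exact: fixsetK (F_mono S). Qed.

Lemma dominated_observed S : dominated G S \subset observed G S.
Proof. by rewrite -observed_fixed subsetUl. Qed.

Lemma sub_observed S : S \subset observed G S.
Proof. by apply: subset_trans (dominated_observed S); exact: subsetUl. Qed.

Lemma observed_adj S u v : u \in S -> G u v -> v \in observed G S.
Proof.
move=> uS uv; apply: (subsetP (dominated_observed S)).
by apply/dominatedP; right; exists u.
Qed.

Lemma observed_force S v w :
  v \in observed G S -> G v w ->
  (forall u, G v u -> u != w -> u \in observed G S) -> w \in observed G S.
Proof.
move=> vS vw vu; rewrite -observed_fixed !in_setU.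
case: (boolP (w \in observed G S)) => [_|wS]; first by rewrite orbT.
by apply/orP; right; apply/forcedP; exists v.
Qed.

(** Every stage of the iteration behind [fixset] stays inside [B]. Monotonicity, localization to a
    region and the correctness of the worklist all rest on this minimality. *)
Lemma observed_min S B :
  dominated G S \subset B ->
  (forall v w, v \in B -> G v w ->
     (forall u, G v u -> u != w -> u \in B) -> w \in B) ->
  observed G S \subset B.
Proof.
move=> domB closedB; rewrite /observed /fixset.
elim: #|V| => [|n IH] /=; first exact: sub0set.
rewrite -/(F S _) /F; apply/subsetP => w; rewrite in_setU => /orP[/(subsetP domB)//|].
move/subsetP: IH => IH; rewrite in_setU => /orP[/IH//|/forcedP[v [vA vw _ vu]]].
apply: (closedB v) => // [|u vu' uw]; first exact: IH.
exact/IH/vu.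
Qed.

Lemma observedS S S' : S \subset S' -> observed G S \subset observed G S'.
Proof.
move=> /subsetP sSS'; apply: observed_min; last by move=> v w; exact: observed_force.
apply/subsetP => v /dominatedP[/sSS'|[u /sSS' uS uv]].
  exact: (subsetP (sub_observed S')).
exact: observed_adj uS uv.
Qed.

Lemma nbrP R v : reflect (v \notin R /\ exists2 u, u \in R & G u v) (v \in nbr G R).
Proof.
rewrite inE; apply: (iffP andP) => -[vR h]; split=> //.
  by have /existsP[u /andP[uR uv]] := h; exists u.
by have [u uR uv] := h; apply/existsP; exists u; rewrite uR.
Qed.

(* The nodes outside R count as observed, so only the edges leaving R matter. *)
Lemma observed_region S S' R :
  (forall v, v \in R -> v \in S -> v \in observed G S') ->
  (forall u v, v \in R -> u \in S -> G u v -> v \in observed G S') ->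
  (forall u v, u \in R -> v \notin R -> G u v ->
     u \in observed G S' /\ v \in observed G S') ->
  R :&: observed G S \subset observed G S'.
Proof.
move=> SR domR bdR; suff /subsetP h: observed G S \subset ~: R :|: observed G S'.
  by apply/subsetP => v /setIP[vR /h]; rewrite !inE vR.
apply: observed_min => [|v w].
  apply/subsetP => v vS; rewrite !inE; case: (boolP (v \in R)) => //= vR.
  by case/dominatedP: vS => [|[u]]; [exact: SR|exact: domR].
rewrite !inE => vB vw vu; case: (boolP (w \in R)) => //= wR.
case: (boolP (v \in R)) vB => /= [vR vS'|vR _]; last first.
  by have [] := bdR w v wR vR; rewrite // adj_sym.
apply: (observed_force vS' vw) => u vu' uw; have := vu u vu' uw; rewrite !inE.
by case: (boolP (u \in R)) => //= uR _; have [] := bdR v u vR uR vu'.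
Qed.

Lemma power_dominates_full : power_dominates G [set: V].
Proof. by rewrite /power_dominates -subTset sub_observed. Qed.

Lemma Opt_witness : exists2 S, power_dominates G S & #|S| = Opt G.
Proof.
rewrite /Opt; case: arg_minnP; first exact: power_dominates_full.
by move=> S pS _; exists S.
Qed.

End Observed.

(** * The approximation ratio *)

Section Decomposition.
Variables (V : finType) (G : sgraph V) (I : finType) (D : tree_decomp G I) (r : I).
Implicit Types (S : {set V}) (P : {set I}) (u v : V) (q c : I).
Local Notation T := (td_tree D).
Local Notation par := (parent (td_treeP D) r).
Local Notation Y := (Y D r).

Lemma YP q v : reflect (exists2 i, i \in subtree T r q & v \in bag D i) (v \in Y q).
Proof. exact: bigcupP. Qed.

Lemma bag_sub_Y q : bag D q \subset Y q.
Proof.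
by apply/subsetP => v vq; apply/YP; exists q => //; exact: (subtree_refl (td_treeP D)).
Qed.

Lemma Y_sub_parent c : c != r -> Y c \subset Y (par c).
Proof.
move=> cr; apply/subsetP => v /YP[i ic vi]; apply/YP; exists i => //.
exact: subtree_parent.
Qed.

Lemma Y_child q v : v \in Y q ->
  v \in bag D q \/ exists c, [/\ c != r, par c = q & v \in Y c].
Proof.
case/YP => i iq vi; case: (eqVneq i q) => [<-|niq]; first by left.
have [c [cr pc ic]] := subtree_child (td_treeP D) iq niq.
by right; exists c; split=> //; apply/YP; exists i.
Qed.

Lemma Y_root : Y r = [set: V].
Proof.
apply/setP => v; rewrite inE; have: v \in [set: V] by [].
rewrite -(bag_cover D) => /bigcupP[i _ vi]; apply/YP; exists i => //.
exact: (subtree_root (td_treeP D)).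
Qed.

(** Some bag inside the subtree and the bag of [i] outside both contain [u]; the tree path between
    them runs through [q] and its parent, so the path axiom puts [u] into these two bags. *)
Lemma Y_boundary q u i :
  u \in Y q -> i \notin subtree T r q -> u \in bag D i ->
  u \in bag D q /\ u \in bag D (par q).
Proof.
case/YP => j jq uj iq ui; have [_ h1 h2] := on_path_exit (td_treeP D) jq iq.
by split; [apply: (subsetP (bag_path h1))|apply: (subsetP (bag_path h2))]; rewrite inE uj.
Qed.

(** A bag containing both ends of the edge cannot belong to the subtree, because [v] is outside the
    region; so [Y_boundary] applies to [u]. *)
Lemma Y_exit q u v : u \in Y q -> v \notin Y q -> G u v ->
  [/\ q != r, u \in bag D q & u \in bag D (par q)].
Proof.
move=> uq vq /(bag_edge D)[i /andP[ui vi]].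
have iq : i \notin subtree T r q by apply: contra vq => iq; apply/YP; exists i.
have [h1 h2] := Y_boundary uq iq ui.
by split=> //; apply: contraNneq vq => ->; rewrite Y_root inE.
Qed.

Lemma strong_regionS S S' R :
  S \subset S' -> strong_region G S' R -> strong_region G S R.
Proof.
move=> sSS'; apply: contra => /subset_trans; apply.
by apply/observedS/setSU.
Qed.

(** The region of a child [c] is observed by [S] together with its neighbors. Its outgoing edges
    start in the bag of [q], hence in [S], so adding those neighbors gives nothing inside the region
    that [S] does not already give. *)
Lemma Y_observed S q :
  bag D q \subset S ->
  (forall c, c != r -> par c = q -> ~~ strong_region G S (Y c)) ->
  Y q \subset observed G S.
Proof.
move=> /subsetP qS children; apply/subsetP => v /Y_child[/qS|[c [cr pc vc]]].
  exact: (subsetP (sub_observed G S)).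
have := children c cr pc; rewrite negbK => /subsetP sub.
have bd x y : x \in Y c -> y \notin Y c -> G x y -> x \in S.
  by move=> xc yc xy; have [_ _] := Y_exit xc yc xy; rewrite pc; exact: qS.
have := @observed_region V G (S :|: nbr G (Y c)) S (Y c).
move=> h; apply: (subsetP (h _ _ _)); last by rewrite inE vc sub.
- move=> x xc; rewrite inE => /orP[/(subsetP (sub_observed G S))//|].
  by case/nbrP; rewrite xc.
- move=> x y yc; rewrite inE => /orP[xS|/nbrP[xc _]] xy; first exact: observed_adj xS xy.
  by apply: (subsetP (sub_observed G S)); apply: (bd y x); rewrite // adj_sym.
- move=> x y xc yc xy; have xS := bd x y xc yc xy.
  by split; [exact: (subsetP (sub_observed G S))|exact: observed_adj xS xy].
Qed.

Lemma Y_neighbors_observed S q x y :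
  bag D q \subset S -> Y q \subset observed G S -> x \in Y q -> G x y ->
  y \in observed G S.
Proof.
move=> /subsetP qS /subsetP Yq xq xy; case: (boolP (y \in Y q)) => [/Yq//|yq].
have [_ xb _] := Y_exit xq yq xy; exact: observed_adj (qS _ xb) xy.
Qed.

(** Suppose [S0] meets [Y q] only in [U]. Those elements are exhausted, being observed along with
    their neighbors, and the other elements of [S0] act on [Y q] only from [nbr G (Y q)], which the
    strength test grants. The test set then observes all of [Y q]. *)
Lemma strong_region_new S S0 (U : {set V}) q :
  power_dominates G S0 ->
  (forall x, x \in U -> x \in observed G S /\ forall y, G x y -> y \in observed G S) ->
  strong_region G S (Y q) -> exists2 x, x \in S0 & x \in Y q :\: U.
Proof.
move=> /eqP pd0 obsU strong.
case: (pickP [pred x | (x \in S0) && (x \in Y q :\: U)]) => [x /andP[]|none].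
  by exists x.
have inU x : x \in S0 -> x \in Y q -> x \in U.
  by move=> x0 xq; have := none x; rewrite /= x0 !inE xq andbT => /negbFE.
have mono := subsetP (observedS G (subsetUl S (nbr G (Y q)))).
case/negP: strong; have := @observed_region V G S0 (S :|: nbr G (Y q)) (Y q).
rewrite pd0 setIT; apply.
- by move=> x xq x0; apply: mono; have [] := obsU x (inU _ x0 xq).
- move=> x y yq x0 xy; case: (boolP (x \in Y q)) => [xq|xq].
    by apply: mono; have [_] := obsU x (inU _ x0 xq); apply.
  apply: (@observed_adj _ _ _ x) => //; rewrite inE; apply/orP; right.
  by apply/nbrP; split=> //; exists y; rewrite // adj_sym.
- move=> x y xq yq xy; have yn : y \in S :|: nbr G (Y q).
    by rewrite inE; apply/orP; right; apply/nbrP; split=> //; exists x.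
  split; last exact: (subsetP (sub_observed G _)).
  by apply: (observed_adj yn); rewrite adj_sym.
Qed.

(* U collects the regions Y q found strong so far; each of them contains an   *)
(* element of the solution S0 that lies in no earlier one.                    *)
Definition alg_invariant (S0 : {set V}) (P : {set I}) S :=
  (forall q, q \in P -> ~~ strong_region G S (Y q)) /\
  exists U : {set V},
    (forall x, x \in U ->
       x \in observed G S /\ forall y, G x y -> y \in observed G S) /\
    #|S| <= (width D).+1 * #|S0 :&: U|.

Lemma card_bag q : #|bag D q| <= (width D).+1.
Proof.
apply: leq_trans (leqSpred _).
exact: (@leq_bigmax _ (fun i => #|bag D i|) q).
Qed.

(** If the region is strong, the bag pays for at most [(width D).+1] nodes, and enlarging [U] by
    [Y q] gains a new element of [S0]. The hypothesis on children is what the bottom-up order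
    supplies. *)
Lemma alg_step_invariant S0 P S q :
  power_dominates G S0 -> (forall c, c != r -> par c = q -> c \in P) ->
  alg_invariant S0 P S -> alg_invariant S0 (q |: P) (alg_step D r S q).
Proof.
move=> pd0 chP [nstrong [U [obsU cardS]]]; rewrite /alg_step.
case: ifPn => [strong|nst]; last first.
  split; last by exists U.
  by move=> q'; rewrite !inE => /orP[/eqP ->|/nstrong].
have sS : S \subset S :|: bag D q := subsetUl _ _.
have obsq : Y q \subset observed G (S :|: bag D q).
  apply: Y_observed; first exact: subsetUr.
  by move=> c cr pc; apply: contra (nstrong c (chP c cr pc)); exact: strong_regionS.
split.
  move=> q'; rewrite !inE => /orP[/eqP ->|/nstrong]; last first.
    by apply: contra; exact: strong_regionS.
  by rewrite negbK; apply: subset_trans obsq _; apply/observedS/subsetUl.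
exists (U :|: Y q); split=> [x|].
  rewrite inE => /orP[/obsU [xS yS]|xq].
    by split=> [|y /yS]; apply: (subsetP (observedS _ sS)).
  split; first exact: (subsetP obsq).
  by move=> y; apply: (@Y_neighbors_observed _ q) => //; exact: subsetUr.
have [x x0] := strong_region_new pd0 obsU strong; rewrite inE => /andP[xU xq].
apply: leq_trans (leq_card_setU S (bag D q)) _.
apply: (@leq_trans ((width D).+1 * (#|S0 :&: U|).+1)).
  by rewrite mulnS addnC leq_add ?card_bag.
rewrite leq_mul2l; apply/orP; right; apply: proper_card; apply/properP; split.
  exact/setIS/subsetUl.
by exists x; rewrite !inE ?x0 ?xq ?orbT // (negPf xU).
Qed.

Lemma alg_foldl_invariant S0 P S ls :
  power_dominates G S0 ->
  (forall q c, q \in ls -> c != r -> par c = q -> c \in P) ->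
  alg_invariant S0 P S ->
  alg_invariant S0 (P :|: [set q in ls]) (foldl (alg_step D r) S ls).
Proof.
move=> pd0; elim: ls P S => [|q ls IH] P S /= chP inv.
  rewrite (_ : _ :|: _ = P) //; apply/setP => x; rewrite !inE.
  by rewrite in_nil orbF.
have -> : P :|: [set q' in q :: ls] = (q |: P) :|: [set q' in ls].
  by apply/setP => x; rewrite !inE orbCA orbA.
apply: IH => [q' c q'ls cr pc|]; first by rewrite inE (chP q') ?orbT // inE q'ls orbT.
by apply: alg_step_invariant => // c; apply: chP; rewrite mem_head.
Qed.

Lemma algorithm_invariant S0 ord :
  power_dominates G S0 -> level_order D r ord ->
  alg_invariant S0 [set: I] (algorithm D r ord).
Proof.
move=> pd0 lo; rewrite /algorithm.
(* With [n] levels still to go, exactly the nodes at distance at least [n] are done; the children of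
   a node at distance [n - 1] are among them. *)
suff levels n S : alg_invariant S0 [set q | n <= dist T r q] S ->
    alg_invariant S0 [set: I]
      (foldl (fun S l => foldl (alg_step D r) S (ord l)) S (rev (iota 0 n))).
  apply: levels; split=> [q|]; last first.
    by exists set0; rewrite cards0; split=> // x; rewrite inE.
  by rewrite inE ltnNge /depth (@leq_bigmax _ (fun i => dist T r i)).
elim: n S => [|n IH] S inv.
  by rewrite (_ : setT = [set q | 0 <= dist T r q]) //; apply/setP => q; rewrite !inE.
rewrite -[n.+1]addn1 iotaD rev_cat /=; apply: IH.
have mem_ord q : (q \in ord n) = (dist T r q == n).
  by rewrite (perm_mem (lo n)) mem_enum inE.
rewrite (_ : [set q | _] = [set q | n < dist T r q] :|: [set q in ord n]).
  apply: alg_foldl_invariant => // q c; rewrite mem_ord => /eqP dq cr pc.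
  by rewrite inE (dist_parent (td_treeP D) cr) pc dq.
by apply/setP => q; rewrite !inE mem_ord leq_eqVlt eq_sym orbC.
Qed.

Theorem algorithm_approximates ord : level_order D r ord ->
  power_dominates G (algorithm D r ord) /\
  #|algorithm D r ord| <= (width D + 1) * Opt G.
Proof.
move=> lo; have [S0 pd0 <-] := Opt_witness G.
have [nstrong [U [_ cardS]]] := algorithm_invariant pd0 lo; split; last first.
  rewrite addn1; apply: leq_trans cardS _.
  by rewrite leq_mul2l subset_leq_card ?orbT ?subsetIl.
(* The region of the root is everything, so its set of neighbors is empty and the test set is the
   output itself. *)
have := nstrong r (in_setT _); rewrite negbK Y_root => full.
rewrite /power_dominates -subTset; apply: subset_trans full (observedS _ _).
by apply/subsetP => v; rewrite !inE => /orP[].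
Qed.

End Decomposition.


(** * A program logic with time bounds *)

Definition run (c : cmd) (s : memory) (T : nat) (Q : memory -> Prop) : Prop :=
  exists t s', [/\ exec c s t s', t <= T & Q s'].

Fixpoint written_regs (c : cmd) : seq nat :=
  match c with
  | Const x _ | Add x _ _ | Defs.Sub x _ _ | Read x _ _ => [:: x]
  | Write _ _ _ => [::]
  | Seq c1 c2 | IfLt _ _ c1 c2 => written_regs c1 ++ written_regs c2
  | WhileLt _ _ c => written_regs c
  end.

Fixpoint written_arrs (c : cmd) : seq nat :=
  match c with
  | Const _ _ | Add _ _ _ | Defs.Sub _ _ _ | Read _ _ _ => [::]
  | Write a _ _ => [:: a]
  | Seq c1 c2 | IfLt _ _ c1 c2 => written_arrs c1 ++ written_arrs c2
  | WhileLt _ _ c => written_arrs c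
  end.

(** The syntactic write sets bound what a program can change, so a specification needs to mention
    only what is computed; [run_frame] makes the frame available in every postcondition. *)
Definition frame (c : cmd) (s s' : memory) : Prop :=
  (forall x, x \notin written_regs c -> reg s' x = reg s x) /\
  (forall a, a \notin written_arrs c -> arr s' a = arr s a).

Lemma frame_refl c s : frame c s s.
Proof. by []. Qed.

Lemma frame_trans c s1 s2 s3 : frame c s1 s2 -> frame c s2 s3 -> frame c s1 s3.
Proof. by move=> [r1 a1] [r2 a2]; split=> x xc; rewrite ?r2 ?a2 ?r1 ?a1. Qed.

Lemma frame_sub c c' s s' :
  {subset written_regs c <= written_regs c'} ->
  {subset written_arrs c <= written_arrs c'} ->
  frame c s s' -> frame c' s s'.
Proof.
move=> sr sa [fr fa]; split=> x xc.
  by apply: fr; apply: contra xc; exact: sr.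
by apply: fa; apply: contra xc; exact: sa.
Qed.

Lemma exec_frame c s t s' : exec c s t s' -> frame c s s'.
Proof.
elim=> {c s t s'} //=.
- by move=> s x n; split=> //= y; rewrite inE => /negPf ->.
- by move=> s x n y; split=> //= z; rewrite inE => /negPf ->.
- by move=> s x n y; split=> //= z; rewrite inE => /negPf ->.
- by move=> s x n y; split=> //= z; rewrite inE => /negPf ->.
- move=> s a x y; split=> //= z; rewrite inE => /negPf za.
  by rewrite /set_arr /= za.
- move=> c1 c2 s1 s2 s3 t1 t2 _ f1 _ f2.
  apply: frame_trans (frame_sub _ _ f1) (frame_sub _ _ f2) => x /=;
    by rewrite mem_cat => ->; rewrite ?orbT.
- move=> x y c1 c2 s s' t _ _ f1; apply: frame_sub f1 => z /=;
    by rewrite mem_cat => ->; rewrite ?orbT.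
- move=> x y c1 c2 s s' t _ _ f1; apply: frame_sub f1 => z /=;
    by rewrite mem_cat => ->; rewrite ?orbT.
- by move=> x y c s1 s2 s3 t1 t2 _ _ f1 _ f2; apply: frame_trans f1 f2.
Qed.

Lemma run_frame c s T Q : run c s T (fun s' => frame c s s' -> Q s') -> run c s T Q.
Proof.
by move=> [t [s' [e tT h]]]; exists t, s'; split=> //; apply: h; apply: exec_frame e.
Qed.

Lemma run_weaken c s T T' (Q Q' : memory -> Prop) :
  run c s T Q -> T <= T' -> (forall s', Q s' -> Q' s') -> run c s T' Q'.
Proof.
by move=> [t [s' [e tT h]]] le QQ'; exists t, s'; split=> //; [apply: leq_trans le|exact: QQ'].
Qed.

Lemma run_le c s T T' Q : run c s T Q -> T <= T' -> run c s T' Q.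
Proof. by move=> h le; exact: run_weaken h le _. Qed.

Lemma run_seq c1 c2 s T1 T2 Q :
  run c1 s T1 (fun s1 => frame c1 s s1 -> run c2 s1 T2 Q) ->
  run (Seq c1 c2) s (T1 + T2) Q.
Proof.
move=> /run_frame [t1 [s1 [e1 l1 [t2 [s2 [e2 l2 h]]]]]].
by exists (t1 + t2), s2; split=> //; [exact: ExecSeq e1 e2|exact: leq_add].
Qed.

Lemma run_if x y c1 c2 s T Q :
  (reg s x < reg s y -> run c1 s T Q) ->
  (reg s y <= reg s x -> run c2 s T Q) -> run (IfLt x y c1 c2) s T.+1 Q.
Proof.
move=> h1 h2; case: (ltnP (reg s x) (reg s y)) => [lt|le].
  by have [t [s' [e l h]]] := h1 lt; exists t.+1, s'; split=> //; exact: ExecIfTrue.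
by have [t [s' [e l h]]] := h2 le; exists t.+1, s'; split=> //; exact: ExecIfFalse.
Qed.

(* Inv phi s: phi pays for the rest of the loop started in s. *)
Lemma run_while x y c s0 (Inv : nat -> memory -> Prop) phi0 Q :
  Inv phi0 s0 ->
  (forall phi s, frame c s0 s -> Inv phi s -> reg s x < reg s y ->
     exists T, run c s T (fun s' => frame c s s' ->
                exists2 phi', T.+1 + phi' <= phi & Inv phi' s')) ->
  (forall phi s, frame c s0 s -> Inv phi s -> reg s y <= reg s x -> Q s) ->
  run (WhileLt x y c) s0 phi0.+1 Q.
Proof.
move=> inv0 step exit; move: (frame_refl c s0) inv0.
move: {2 3 4}s0 (leqnn phi0) => s; move: {1 3 4}phi0 s => phi s.
elim: phi0 phi s => [|N IH] phi s le f inv.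
  case: (ltnP (reg s x) (reg s y)) => [lt|ge]; last first.
    by exists 1, s; split=> //; [exact: ExecWhileFalse|exact: exit f inv ge].
  have [T /run_frame[t [s' [e l [phi' h _]]]]] := step phi s f inv lt.
  by move: h; lia.
case: (ltnP (reg s x) (reg s y)) => [lt|ge]; last first.
  by exists 1, s; split=> //; [exact: ExecWhileFalse|exact: exit f inv ge].
have [T /run_frame[t [s' [e l [phi' h inv']]]]] := step phi s f inv lt.
have f' : frame c s0 s' := frame_trans f (exec_frame e).
have [|t' [s'' [e' l' q]]] := IH phi' s' _ f' inv'; first by lia.
exists (t + t').+1, s''; split=> //; first exact: ExecWhileTrue e e'.
by lia.
Qed.

Fixpoint loop_free (c : cmd) : bool :=
  match c with
  | Seq c1 c2 | IfLt _ _ c1 c2 => loop_free c1 && loop_free c2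
  | WhileLt _ _ _ => false
  | _ => true
  end.

Fixpoint cmd_size (c : cmd) : nat :=
  match c with
  | Seq c1 c2 => cmd_size c1 + cmd_size c2
  | IfLt _ _ c1 c2 => (maxn (cmd_size c1) (cmd_size c2)).+1
  | _ => 1
  end.

(* Junk on loops, which it skips. *)
Fixpoint effect (c : cmd) (s : memory) : memory :=
  match c with
  | Const x n => set_reg s x n
  | Add x y z => set_reg s x (reg s y + reg s z)
  | Defs.Sub x y z => set_reg s x (reg s y - reg s z)
  | Read x a y => set_reg s x (arr s a (reg s y))
  | Write a x y => set_arr s a (reg s x) (reg s y)
  | Seq c1 c2 => effect c2 (effect c1 s)
  | IfLt x y c1 c2 => if reg s x < reg s y then effect c1 s else effect c2 s
  | WhileLt _ _ _ => s
  end.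

(** Symbolic execution: straight-line blocks are verified by computing [effect], at the cost of the
    longer branch of each test. *)
Lemma run_effect c s (Q : memory -> Prop) :
  loop_free c -> Q (effect c s) -> run c s (cmd_size c) Q.
Proof.
elim: c s Q => //=.
- by move=> x n s Q _ q; exists 1, (set_reg s x n); split=> //; constructor.
- by move=> x y z s Q _ q; eexists 1, _; split=> //; [constructor|].
- by move=> x y z s Q _ q; eexists 1, _; split=> //; [constructor|].
- by move=> x y z s Q _ q; eexists 1, _; split=> //; [constructor|].
- by move=> x y z s Q _ q; eexists 1, _; split=> //; [constructor|].
- by move=> c1 IH1 c2 IH2 s Q /andP[l1 l2] q; apply: run_seq; apply: IH1 => // _; apply: IH2.
- move=> x y c1 IH1 c2 IH2 s Q /andP[l1 l2]; case: ltnP => h q; apply: run_if; try lia; move=> _.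
    by apply: run_le (leq_maxl _ _); apply: IH1.
  by apply: run_le (leq_maxr _ _); apply: IH2.
Qed.

(* Register 3 holds the constant 1 and register 4 the constant 0. *)
Notation r_one := 3 (only parsing).
Notation r_zero := 4 (only parsing).

Definition skip := Const 30 0.

Definition when_eq x y c := IfLt x y skip (IfLt y x skip c).

Lemma run_skip s (Q : memory -> Prop) : Q (set_reg s 30 0) -> run skip s 1 Q.
Proof. exact: (@run_effect skip). Qed.

Lemma run_when_eq x y c s T (Q : memory -> Prop) :
  (reg s x = reg s y -> run c s T Q) ->
  (reg s x <> reg s y -> Q (set_reg s 30 0)) ->
  run (when_eq x y c) s (T + 3) Q.
Proof.
move=> h1 h2; rewrite (_ : T + 3 = (T + 1).+2); last lia.
apply: run_if => xy; first by apply: run_le (run_skip _) _; [apply: h2; lia|lia].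
apply: run_if => yx; first by apply: run_le (run_skip _) _; [apply: h2; lia|lia].
by apply: run_le (h1 _) _; lia.
Qed.

Definition for_lt i b c :=
  Seq (Const i 0) (WhileLt i b (Seq c (Add i i r_one))).

(** The outer 2 pays for the initialization and the final test, the inner 2 for the test and the
    increment of each round. The costs depend on the round so that they can be summed over
    degrees. *)
Lemma run_for i b c s0 n (Inv : nat -> memory -> Prop) (T : nat -> nat) Q :
  [&& b != i, i != r_one, b \notin written_regs c, r_one \notin written_regs c
    & i \notin written_regs c] ->
  reg s0 r_one = 1 -> reg s0 b = n ->
  Inv 0 (set_reg s0 i 0) ->
  (forall k s, k < n -> frame (for_lt i b c) s0 s -> reg s i = k -> Inv k s ->
     run c s (T k) (fun s' => frame c s s' -> Inv k.+1 (set_reg s' i k.+1))) ->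
  (forall s, frame (for_lt i b c) s0 s -> Inv n s -> Q s) ->
  run (for_lt i b c) s0 (2 + \sum_(k < n) (T k + 2)) Q.
Proof.
case/and5P => bi i1 bc onec ic one0 <- inv0 step exit.
rewrite -[2 + _]/(1 + (1 + _)); apply: run_seq; apply: (@run_effect (Const i 0)) => //= f0.
have sub s : frame (Seq c (Add i i r_one)) (set_reg s0 i 0) s -> frame (for_lt i b c) s0 s.
  move=> f; apply: (frame_trans (s2 := set_reg s0 i 0)).
    by apply: frame_sub f0 => //= x; rewrite !inE => ->.
  by apply: frame_sub f => //= x; rewrite !inE => ->; rewrite orbT.
pose Inv' phi s := exists k, [/\ k <= reg s0 b, reg s i = k, Inv k s
   & phi = \sum_(k <= j < reg s0 b) (T j + 2)].
rewrite add1n -(big_mkord predT (fun k => T k + 2)); apply: (run_while (Inv := Inv')).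
- by exists 0; split=> //=; rewrite eqxx.
- move=> phi s f [k [kb ik inv ephi]]; have f' := sub s f.
  have eb : reg s b = reg s0 b.
    by apply: f'.1; rewrite /= inE mem_cat inE !negb_or bi bc.
  rewrite ik eb => lt; exists (T k + 1); apply: run_seq.
  apply: run_weaken (step k s lt f' ik inv) (leqnn _) _ => s' h f1.
  have {}h := h f1.
  have ei : reg s' i = k by rewrite f1.1 ?ic.
  have e1 : reg s' r_one = 1.
    by rewrite f1.1 // f'.1 //= inE mem_cat inE !negb_or eq_sym i1 onec.
  apply: (@run_effect (Add i i r_one)) => //= _.
  exists (\sum_(k.+1 <= j < reg s0 b) (T j + 2)).
    by rewrite ephi [in X in _ <= X]big_ltn //; lia.
  exists k.+1; split=> //=; first by rewrite eqxx ei e1 addn1.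
  by rewrite ei e1 addn1.
- move=> phi s f [k [kb ik inv _]]; have f' := sub s f.
  have eb : reg s b = reg s0 b.
    by apply: f'.1; rewrite /= inE mem_cat inE !negb_or bi bc.
  rewrite eb ik => ge; apply: exit => //.
  by rewrite (_ : reg s0 b = k) //; lia.
Qed.


(** * Codes of elements and loops over finite types and lists *)

Definition code (A : finType) (a : A) : nat := enum_rank a.

Section Codes.
Variable A : finType.
Implicit Types a b : A.

Lemma code_lt a : code a < #|A|.
Proof. exact: ltn_ord. Qed.

Lemma code_inj : injective (@code A).
Proof. by move=> a b /ord_inj /enum_rank_inj. Qed.

Lemma code_eq a b : (code a == code b) = (a == b).
Proof. exact: (inj_eq code_inj). Qed.

Lemma code_onto k : k < #|A| -> exists a, code a = k.
Proof. by move=> lt; exists (enum_val (Ordinal lt)); rewrite /code enum_valK. Qed.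

Lemma code_ltS a b : (code a < (code b).+1) = (a == b) || (code a < code b).
Proof. by rewrite ltnS leq_eqVlt code_eq. Qed.

Lemma take_code a : take (code a).+1 (enum A) = rcons (take (code a) (enum A)) a.
Proof. by rewrite (take_nth a) ?nth_enum_rank // -cardE code_lt. Qed.

End Codes.

Lemma run_for_all i b c s0 (A : finType) (Inv : nat -> memory -> Prop) (T : A -> nat) Q :
  [&& b != i, i != r_one, b \notin written_regs c, r_one \notin written_regs c
    & i \notin written_regs c] ->
  reg s0 r_one = 1 -> reg s0 b = #|A| ->
  Inv 0 (set_reg s0 i 0) ->
  (forall a s, frame (for_lt i b c) s0 s -> reg s i = code a -> Inv (code a) s ->
     run c s (T a) (fun s' => frame c s s' ->
       Inv (code a).+1 (set_reg s' i (code a).+1))) ->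
  (forall s, frame (for_lt i b c) s0 s -> Inv #|A| s -> Q s) ->
  run (for_lt i b c) s0 (2 + \sum_a (T a + 2)) Q.
Proof.
move=> side e1 eb inv0 step exit.
(* The costs are transported from elements to indices; 0 is a dummy beyond the range. *)
pose T' k := if insub k is Some k' then T (enum_val (k' : 'I_#|A|)) else 0.
have -> : \sum_a (T a + 2) = \sum_(k < #|A|) (T' k + 2).
  rewrite (reindex_onto (@enum_val A predT) enum_rank) /=; last by move=> a _; exact: enum_rankK.
  apply: eq_big => k; first by rewrite enum_valK eqxx.
  by rewrite /T' valK.
apply: (run_for (Inv := Inv)) => // k s lt; have [a <-] := code_onto lt => f ia inv.
by rewrite (_ : T' (code a) = T a); [exact: step|rewrite /T' /code valK enum_rankK].
Qed.

(** The compressed row format of the input, stated locally: consecutive offsets delimit the segment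
    of [dat] that holds one list. *)
Definition lists_at (m : nat -> nat -> nat) off dat (A B : finType) (l : A -> seq B) :=
  forall a, m off (code a).+1 = m off (code a) + size (l a) /\
    forall j, j < size (l a) ->
      m dat (m off (code a) + j) = nth 0 [seq code b | b <- l a] j.

Lemma lists_at_input (A B : finType) (l : A -> seq B) m off dat :
  (forall i, m off i = if i <= #|A| then offset l i else 0) ->
  (forall i, m dat i = nth 0 (flat_lists l) i) -> lists_at m off dat l.
Proof.
move=> hoff hdat a; have lt := code_lt a.
have dropE : drop (code a) (enum A) = a :: drop (code a).+1 (enum A).
  by rewrite (drop_nth a) ?nth_enum_rank // -cardE.
have offE : offset l (code a).+1 = offset l (code a) + size (l a).
  rewrite /offset -[take (code a).+1 _]map_take take_code map_rcons sumn_rcons.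
  by rewrite map_take.
rewrite !hoff (ltnW lt) lt; split=> // j jl; rewrite hdat /flat_lists.
rewrite -{1}(cat_take_drop (code a) (enum A)) dropE map_cat flatten_cat nth_cat.
have -> : offset l (code a) = size (flatten
    [seq [seq nat_of_ord (enum_rank b) | b <- l a0] | a0 <- take (code a) (enum A)]).
  rewrite size_flatten /shape -map_comp /offset -[in LHS]map_take; congr sumn.
  by apply: eq_map => x /=; rewrite size_map.
by rewrite ltnNge leq_addr /= addKn nth_cat size_map jl.
Qed.

Definition for_each off dat x c :=
  Seq (Seq (Read 10 off x) (Seq (Add 11 x r_one) (Read 11 off 11)))
      (WhileLt 10 11 (Seq (Read 12 dat 10) (Seq c (Add 10 10 r_one)))).

(** The invariant speaks of the prefix already read and must be insensitive to the loop registers 10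
    to 12. Of the 4, three steps load the bounds and one is the final test; the 3 per element are
    the test, the read and the increment. *)
Lemma run_for_each off dat x c s0 (A B : finType) (l : A -> seq B) (a : A)
    (Inv : seq B -> memory -> Prop) T Q :
  [&& x != 10, all (fun y => y \notin written_regs c) [:: r_one; 10; 11],
      off \notin written_arrs c & dat \notin written_arrs c] ->
  reg s0 r_one = 1 -> reg s0 x = code a -> lists_at (arr s0) off dat l ->
  (forall p s s', arr s' = arr s ->
     (forall y, y \notin [:: 10; 11; 12] -> reg s' y = reg s y) -> Inv p s -> Inv p s') ->
  Inv [::] s0 ->
  (forall p u q s, l a = p ++ u :: q -> frame (for_each off dat x c) s0 s ->
     reg s 12 = code u -> Inv p s ->
     run c s T (fun s' => frame c s s' -> Inv (rcons p u) s')) ->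
  (forall s, frame (for_each off dat x c) s0 s -> Inv (l a) s -> Q s) ->
  run (for_each off dat x c) s0 (4 + size (l a) * (T + 3)) Q.
Proof.
case/and4P=> x10 /and4P[onec c10 c11 _] offc datc one0 xa lat stable inv0 step exit.
rewrite -[4 + _]/(3 + _.+1); apply: run_seq; apply: (@run_effect (Seq _ (Seq _ _))) => //= f0.
rewrite (negPf x10) one0 xa addn1 in f0 *.
have [nxt elt] := lat a; set s1 := set_reg _ 11 _.
have r10 : reg s1 10 = arr s0 off (code a) by [].
have r11 : reg s1 11 = arr s0 off (code a) + size (l a) by rewrite /= nxt.
have sub s : frame (Seq (Read 12 dat 10) (Seq c (Add 10 10 r_one))) s1 s ->
    frame (for_each off dat x c) s0 s.
  move=> f; apply: (frame_trans (s2 := s1)).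
    by apply: frame_sub f0 => //= y; rewrite !inE; case/or3P => ->; rewrite ?orbT.
  by apply: frame_sub f => //= y; rewrite !inE => ->; rewrite !orbT.
pose Inv' phi s := exists p q, [/\ l a = p ++ q,
  reg s 10 = arr s0 off (code a) + size p, Inv p s & phi = size q * (T + 3)].
apply: (run_while (Inv := Inv')).
- exists [::], (l a); split=> //; first by rewrite r10 addn0.
  by apply: stable inv0 => //= y; rewrite !inE !negb_or => /and3P[/negPf -> /negPf -> _].
- move=> phi s f [p [q [ela e10 inv ephi]]]; have f' := sub s f.
  have e11 : reg s 11 = reg s1 11.
    by apply: f.1; rewrite /= inE mem_cat inE /= orbF c11.
  rewrite e11 e10 r11 ela size_cat => lt.
  have : q != [::] by case: (q) lt => //=; lia.
  case: q ela ephi lt => // u q ela ephi lt _.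
  have eone s' : frame c (set_reg s 12 (code u)) s' -> reg s' r_one = 1.
    move=> fc; rewrite fc.1 //= f.1 /=; first by rewrite one0.
    by rewrite inE mem_cat inE /= orbF onec.
  have e12 : arr s dat (reg s 10) = code u.
    rewrite f'.2 /= ?cats0 // e10 elt; last by rewrite ela size_cat /=; lia.
    by rewrite ela map_cat nth_cat size_map ltnn subnn.
  exists (1 + (T + 1)); apply: run_seq; apply: (@run_effect (Read 12 dat 10)) => //=.
  rewrite e12 => f2; apply: run_seq.
  have inv2 : Inv p (set_reg s 12 (code u)).
    by apply: stable inv => //= y; rewrite !inE !negb_or => /and3P[_ _ /negPf ->].
  have f3 : frame (for_each off dat x c) s0 (set_reg s 12 (code u)).
    by apply: frame_trans f' _; split=> //= y; rewrite !inE !negb_or => /and5P[_ _ _ /negPf ->].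
  apply: run_weaken (step p u q _ ela f3 _ inv2) (leqnn _) _ => //.
  move=> s' h fc; have {}h := h fc.
  apply: (@run_effect (Add 10 10 r_one)) => //= _.
  exists (size q * (T + 3)); first by rewrite ephi /= mulSn; lia.
  exists (rcons p u), q; split=> //.
  - by rewrite cat_rcons.
  - by rewrite /= (eone _ fc) fc.1 //= e10 size_rcons; lia.
  - by apply: stable h => //= y; rewrite !inE !negb_or => /and3P[/negPf ->].
- move=> phi s f [p [q [ela e10 inv ephi]]]; have f' := sub s f.
  have e11 : reg s 11 = reg s1 11.
    by apply: f.1; rewrite /= inE mem_cat inE /= orbF c11.
  rewrite e11 e10 r11 ela size_cat => ge; apply: exit => //.
  have q0 : q = [::] by case: (q) ge => //= u q'; lia.
  by rewrite ela q0 cats0.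
Qed.


(** * The program *)

(* Registers: 5 round, 6 the value dist + 1 of the current level, 7 current   *)
(* tree node q, 8 start of the row of q, 10 to 12 position, end and element   *)
(* in for_each, 13 current node of G, 20 strong flag, 21 and 22 head and tail *)
(* of the worklist, 23 newly observed node; 14 to 17 are temporary.           *)
(* Arrays: 7 dist + 1 (0 if not yet reached), 8 and 9 start of the row of the *)
(* parent and of the node, 10 table of the regions Y, 11 S :|: nbr Y,         *)
(* 12 observed set, 13 and 14 number and sum of the codes of the unobserved   *)
(* neighbors, 15 worklist.                                                    *)

Section Blocks.
Variables (V : finType) (G : sgraph V) (I : finType) (D : tree_decomp G I) (r : I).
Variables (nbV : V -> seq V) (nbI : I -> seq I) (bags : I -> seq V).
Hypothesis nbVP : lists_of (neighbors G) nbV.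
Hypothesis nbIP : lists_of (neighbors (td_tree D)) nbI.
Hypothesis bagsP : lists_of (bag D) bags.
Implicit Types (S R A Z : {set V}) (u v w : V) (q : I) (s : memory).

Lemma mem_nbV v u : (u \in nbV v) = G v u.
Proof. by have [_ ->] := nbVP v; rewrite inE. Qed.

Lemma nbV_uniq v : uniq (nbV v).
Proof. by have [] := nbVP v. Qed.

Definition arcs := \sum_v size (nbV v).

Record input_ready s : Prop := InputReady {
  ready_V : reg s 0 = #|V|;
  ready_I : reg s 1 = #|I|;
  ready_root : reg s 2 = code r;
  ready_one : reg s r_one = 1;
  ready_zero : reg s r_zero = 0;
  ready_nbV : lists_at (arr s) 0 1 nbV;
  ready_nbI : lists_at (arr s) 2 3 nbI;
  ready_bags : lists_at (arr s) 4 5 bags }.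

Definition keeps_input c :=
  all (fun x => x \notin written_regs c) (iota 0 5) &&
  all (fun a => a \notin written_arrs c) (iota 0 6).

Lemma ready_frame c s s' :
  keeps_input c -> frame c s s' -> input_ready s -> input_ready s'.
Proof.
case/andP=> /allP kr /allP ka [fr fa] [h0 h1 h2 h3 h4 hV hI hB].
have e x : x < 5 -> reg s' x = reg s x by move=> lt; rewrite fr // kr // mem_iota.
have ea a : a < 6 -> arr s' a = arr s a by move=> lt; rewrite fa // ka // mem_iota.
by split; rewrite ?e //; move=> a; rewrite !ea //.
Qed.

(** For passes that fix one table entry per node by scanning its neighbors: a cost of [K] times
    degree plus one sums to a bound linear in nodes and arcs. *)
Lemma run_pointwise c s0 (P : V -> memory -> Prop) K Q :
  keeps_input c -> 13 \notin written_regs c -> input_ready s0 ->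
  (forall v s k, P v s -> P v (set_reg s 13 k)) ->
  (forall v s, input_ready s -> frame (for_lt 13 0 c) s0 s -> reg s 13 = code v ->
     run c s (K * (size (nbV v)).+1)
       (fun s' => frame c s s' -> P v s' /\ forall u, u != v -> P u s -> P u s')) ->
  (forall s, input_ready s -> frame (for_lt 13 0 c) s0 s -> (forall v, P v s) -> Q s) ->
  run (for_lt 13 0 c) s0 ((K + 2) * (#|V| + arcs) + 2) Q.
Proof.
move=> kc c13 rdy stable step exit.
have [/allP kr /allP ka] := andP kc.
have kf : keeps_input (for_lt 13 0 c).
  rewrite /keeps_input; apply/andP; split; apply/allP => x; last by move/ka; rewrite /= cats0.
  move=> xi; have := kr x xi; rewrite /= inE mem_cat inE !negb_or => ->.
  by move: xi; rewrite mem_iota; case: eqP => // ->.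
pose Inv k s := forall v, code v < k -> P v s.
apply: (run_le (T := 2 + \sum_v (K * (size (nbV v)).+1 + 2))); last first.
  rewrite big_split /= -big_distrr /= sum_nat_const.
  under eq_bigr do rewrite -addn1; rewrite big_split /= sum_nat_const muln1 -/arcs.
  by rewrite -[#|xpredT|]/#|V|; nia.
apply: (run_for_all (Inv := Inv)) => //.
- by rewrite (kr 0) // (kr 3) // c13.
- exact: ready_one.
- exact: ready_V.
- move=> v s f iv inv; have rs := ready_frame kf f rdy.
  apply: run_weaken (step v s rs f iv) (leqnn _) _ => s' h /h [Pv Pu] u.
  rewrite code_ltS; case: (eqVneq u v) => [->|uv] /= ; first by move=> _; exact: stable.
  by move=> lt; apply/stable/Pu => //; exact: inv.
- move=> s f inv; apply: exit => //; first exact: ready_frame f rdy.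
  by move=> v; apply: inv; exact: code_lt.
Qed.

Definition seed_body :=
  Seq (Seq (Read 14 6 13) (Seq (Add 17 8 13) (Read 15 10 17)))
  (Seq (IfLt 15 r_one
          (for_each 0 1 13
             (Seq (Add 17 8 12) (Seq (Read 16 10 17) (IfLt r_zero 16 (Const 14 1) skip))))
          skip)
       (Write 11 13 14)).

Lemma run_seed s0 S R :
  input_ready s0 ->
  (forall v, arr s0 6 (code v) = (v \in S)) ->
  (forall v, arr s0 10 (reg s0 8 + code v) = (v \in R)) ->
  run (for_lt 13 0 seed_body) s0 (22 * (#|V| + arcs) + 2)
    (fun s => forall v, arr s 11 (code v) = (v \in S :|: nbr G R)).
Proof.
move=> rdy hS hR.
apply: (run_pointwise (K := 20)
          (P := fun v s => arr s 11 (code v) = (v \in S :|: nbr G R))) => //.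
move=> v s rs f iv.
apply: (run_le (T := 3 + ((4 + size (nbV v) * (4 + 3)).+1 + 1))); last by lia.
apply: run_seq; apply: (@run_effect (Seq _ (Seq _ _))) => //= f1.
rewrite iv (f.2 6 isT) (f.2 10 isT) (f.1 8 isT) hS hR in f1 *; set s1 := set_reg _ 15 _ in f1 *.
have rs1 : input_ready s1 by apply: ready_frame f1 rs.
have fin s2 : reg s2 14 = (v \in S :|: nbr G R) -> reg s2 13 = code v -> arr s2 11 = arr s1 11 ->
  run (Write 11 13 14) s2 1 (fun s' => frame seed_body s s' ->
      arr s' 11 (code v) = (v \in S :|: nbr G R) /\
       forall u, u != v -> arr s 11 (code u) = (u \in S :|: nbr G R) ->
                 arr s' 11 (code u) = (u \in S :|: nbr G R)).
  move=> e14 e13 ea; apply: (@run_effect (Write _ _ _)) => //= _.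
  rewrite e13 eqxx e14; split=> // u uv; rewrite (inj_eq (@code_inj V)) (negPf uv) ea => ->.
  by [].
apply: run_seq; apply: run_if => /=; rewrite (ready_one rs).
- move=> lt; have vR : v \notin R by case: (v \in R) lt.
  apply: (run_for_each (a := v) (l := nbV) (Inv := fun p s =>
      reg s 14 = (v \in S) || has (mem R) p)) => //.
  + exact: ready_one.
  + exact: ready_nbV.
  + by move=> p s2 s2' _ e; rewrite e.
  + by rewrite /= orbF.
  + move=> p u q s2 _ f2 e12 inv; apply: (@run_effect (Seq _ (Seq _ _))) => //=.
    rewrite e12 (f2.2 10 isT) (f2.1 8 isT) /= (f.1 8 isT) (f.2 10 isT) hR.
    rewrite (f2.1 4 isT) (ready_zero rs1) has_rcons /=.
    by case: (u \in R) => _ /=; rewrite ?inv ?orbT.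
  + move=> s2 f2 inv fif; apply: fin.
    * rewrite inv !inE vR /=; congr (nat_of_bool (_ || _)).
      apply/hasP/existsP => -[u]; rewrite ?mem_nbV.
        by move=> vu /= uR; exists u; rewrite uR adj_sym.
      by case/andP=> uR uv; exists u => //; rewrite mem_nbV adj_sym.
    * by rewrite f2.1.
    * by rewrite f2.2.
- move=> ge; have vR : v \in R by case: (v \in R) ge.
  apply: (run_le (T := 1)) => //; apply: run_skip => fif; apply: fin => //=.
  by rewrite !inE vR /= orbF.
Qed.

Definition dominate_body :=
  Seq (Read 14 11 13)
  (Seq (for_each 0 1 13 (Seq (Read 16 11 12) (IfLt r_zero 16 (Const 14 1) skip)))
       (Write 12 13 14)).

Lemma run_dominate s0 S :
  input_ready s0 ->
  (forall v, arr s0 11 (code v) = (v \in S)) ->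
  run (for_lt 13 0 dominate_body) s0 (22 * (#|V| + arcs) + 2)
    (fun s => forall v, arr s 12 (code v) = (v \in dominated G S)).
Proof.
move=> rdy hS.
apply: (run_pointwise (K := 20)
          (P := fun v s => arr s 12 (code v) = (v \in dominated G S))) => //.
move=> v s rs f iv.
apply: (run_le (T := 1 + ((4 + size (nbV v) * (3 + 3)) + 1))); last by lia.
apply: run_seq; apply: (@run_effect (Read _ _ _)) => //= f1.
rewrite iv (f.2 11 isT) hS in f1 *; set s1 := set_reg _ 14 _ in f1 *.
have rs1 : input_ready s1 by apply: ready_frame f1 rs.
apply: run_seq.
apply: (run_for_each (a := v) (l := nbV) (Inv := fun p s =>
    reg s 14 = (v \in S) || has (mem S) p)) => //.
- exact: ready_one.
- exact: ready_nbV.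
- by move=> p s2 s2' _ e; rewrite e.
- by rewrite /= orbF.
- move=> p u q s2 _ f2 e12 inv; apply: (@run_effect (Seq _ _)) => //=.
  rewrite e12 (f2.2 11 isT) /= (f.2 11 isT) hS.
  rewrite (f2.1 4 isT) (ready_zero rs1) has_rcons /=.
  by case: (u \in S) => _ /=; rewrite ?inv ?orbT.
- move=> s2 f2 inv _; have e13 : reg s2 13 = code v by rewrite f2.1.
  have e14 : reg s2 14 = (v \in dominated G S).
    rewrite inv; congr nat_of_bool; apply/orP/dominatedP; case=> h; [by left|right|by left|right].
      by have /hasP[u] := h; rewrite mem_nbV adj_sym; exists u.
    by have [u uS uv] := h; apply/hasP; exists u => //; rewrite mem_nbV adj_sym.
  apply: (@run_effect (Write _ _ _)) => //= _; rewrite e13 eqxx e14; split=> // u uv.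
  by rewrite (inj_eq (@code_inj V)) (negPf uv) (f2.2 12 isT).
Qed.

(** * Closure under Rule 2 by a worklist *)

Definition unobserved_sum (f : V -> nat) (A : {set V}) v :=
  \sum_(u <- nbV v | u \notin A) f u.

Definition count_body :=
  Seq (Seq (Const 14 0) (Const 15 0))
  (Seq (for_each 0 1 13
          (Seq (Read 16 12 12)
               (IfLt 16 r_one (Seq (Add 14 14 r_one) (Add 15 15 12)) skip)))
       (Seq (Write 13 13 14) (Seq (Write 14 13 15) (Write 15 13 13)))).

Lemma run_count s0 A :
  input_ready s0 ->
  (forall v, arr s0 12 (code v) = (v \in A)) ->
  run (for_lt 13 0 count_body) s0 (22 * (#|V| + arcs) + 2)
    (fun s => forall v,
       [/\ arr s 13 (code v) = unobserved_sum (fun=> 1) A v,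
           arr s 14 (code v) = unobserved_sum (@code V) A v
         & arr s 15 (code v) = code v]).
Proof.
move=> rdy hA.
apply: (run_pointwise (K := 20) (P := fun v s =>
       [/\ arr s 13 (code v) = unobserved_sum (fun=> 1) A v,
           arr s 14 (code v) = unobserved_sum (@code V) A v
         & arr s 15 (code v) = code v])) => //.
move=> v s rs f iv.
apply: (run_le (T := 2 + ((4 + size (nbV v) * (4 + 3)) + 3))); last by lia.
apply: run_seq; apply: (@run_effect (Seq _ _)) => //= f1; set s1 := set_reg _ 15 _ in f1 *.
have rs1 : input_ready s1 by apply: ready_frame f1 rs.
apply: run_seq.
apply: (run_for_each (a := v) (l := nbV) (Inv := fun p s =>
    reg s 14 = \sum_(u <- p | u \notin A) 1 /\
    reg s 15 = \sum_(u <- p | u \notin A) code u)) => //.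
- exact: ready_one.
- exact: ready_nbV.
- by move=> p s2 s2' _ e; rewrite !e.
- by rewrite !big_nil.
- move=> p u q s2 _ f2 e12 [i14 i15]; apply: (@run_effect (Seq _ _)) => //=.
  rewrite e12 (f2.2 12 isT) /= (f.2 12 isT) hA.
  rewrite (f2.1 3 isT) (ready_one rs1) -cats1 !big_cat /= !(big_cons _ _ u) !big_nil.
  by case: (u \in A) => _ /=; rewrite i14 i15 ?e12 ?addn0 ?(f2.1 3 isT) ?(ready_one rs1).
- move=> s2 f2 [i14 i15] _; have e13 : reg s2 13 = code v by rewrite f2.1.
  apply: (@run_effect (Seq _ (Seq _ _))) => //= _.
  rewrite e13 eqxx i14 i15; split=> // u uv.
  by rewrite !(inj_eq (@code_inj V)) (negPf uv) /= (f2.2 13 isT) (f2.2 14 isT) (f2.2 15 isT).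
Qed.

(** Observing [w] alters the counts and sums only at its neighbors, by 1 and by its code, so
    updating them takes one scan of the list of [w]. *)
Lemma unobserved_sumU1 f A w v : w \notin A ->
  unobserved_sum f A v = unobserved_sum f (w |: A) v + (v \in nbV w) * f w.
Proof.
move=> wA; rewrite /unobserved_sum (bigID (pred1 w)) /= addnC; congr (_ + _).
  by apply: eq_bigl => u; rewrite !inE negb_or andbC.
rewrite (eq_bigl (pred1 w)); last first.
  by move=> u /=; case: (eqVneq u w) => [->|]; rewrite ?wA ?andbF.
rewrite mem_nbV adj_sym -mem_nbV; case: (boolP (w \in nbV v)) => wv.
  rewrite big_mkcond (bigD1_seq w) ?nbV_uniq //= eqxx mul1n big1 ?addn0 // => u.
  by move/negPf->.
by rewrite big1_seq // => u /andP[/eqP -> uv]; rewrite uv in wv.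
Qed.

Lemma unobserved_one A v : unobserved_sum (fun=> 1) A v = 1 ->
  exists w, [/\ w \notin A, G v w, forall u, G v u -> u != w -> u \in A
               & unobserved_sum (@code V) A v = code w].
Proof.
rewrite /unobserved_sum sum1_count -size_filter -big_filter.
case e: [seq u <- nbV v | u \notin A] => [|w [|w' l]] // _.
have mem u : (u \notin A) && G v u = (u == w).
  by have := mem_filter (fun u => u \notin A) u (nbV v); rewrite e inE mem_nbV => ->.
have := mem w; rewrite eqxx => /andP[wA vw]; exists w; split=> //; last by rewrite big_seq1.
by move=> u vu uw; have := mem u; rewrite vu andbT (negPf uw) => /negbFE.
Qed.

Lemma unobserved_oneE A v w : w \notin A -> G v w ->
  (forall u, G v u -> u != w -> u \in A) -> unobserved_sum (fun=> 1) A v = 1.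
Proof.
move=> wA vw vu; rewrite /unobserved_sum sum1_count.
rewrite (@eq_in_count _ _ (pred1 w)); last first.
  move=> u; rewrite mem_nbV => gu /=; case: eqVneq => [->//|/(vu u gu) ->//].
by rewrite count_uniq_mem ?nbV_uniq // mem_nbV vw.
Qed.

Definition observe_body :=
  Seq (Read 16 13 12) (Seq (Defs.Sub 16 16 r_one) (Seq (Write 13 12 16)
  (Seq (Read 16 14 12) (Seq (Defs.Sub 16 16 23) (Seq (Write 14 12 16)
  (Seq (Write 15 22 12) (Add 22 22 r_one))))))).

Definition propagate_body :=
  Seq (Seq (Read 14 15 21) (Seq (Add 21 21 r_one) (Read 15 12 14)))
  (IfLt r_zero 15
    (Seq (Read 16 13 14)
      (when_eq 16 r_one
        (Seq (Seq (Read 23 14 14) (Write 12 23 r_one))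
        (Seq (for_each 0 1 23 observe_body)
             (Seq (Write 15 22 23) (Add 22 22 r_one))))))
    skip).

Definition propagate :=
  Seq (Seq (Const 21 0) (Add 22 0 r_zero)) (WhileLt 21 22 propagate_body).

(* The worklist, entries h to t - 1 of array 15, contains every observed node *)
(* with a single unobserved neighbor; the code of the latter is then the sum  *)
(* kept in array 14.                                                          *)
Record worklist_state (Z A : {set V}) (h t : nat) s : Prop := WorklistState {
  wl_head : reg s 21 = h;
  wl_tail : reg s 22 = t;
  wl_obs : forall v, arr s 12 (code v) = (v \in A);
  wl_count : forall v, arr s 13 (code v) = unobserved_sum (fun=> 1) A v;
  wl_sum : forall v, arr s 14 (code v) = unobserved_sum (@code V) A v;
  wl_nodes : forall i, h <= i < t -> exists v, arr s 15 i = code v;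
  wl_pending : forall v, v \in A -> unobserved_sum (fun=> 1) A v = 1 ->
    exists2 i, h <= i < t & arr s 15 i = code v;
  wl_dom : dominated G Z \subset A;
  wl_sound : A \subset observed G Z }.

Lemma run_observe s0 A w t :
  input_ready s0 -> reg s0 23 = code w -> reg s0 22 = t -> w \notin A ->
  (forall v, arr s0 13 (code v) = unobserved_sum (fun=> 1) A v) ->
  (forall v, arr s0 14 (code v) = unobserved_sum (@code V) A v) ->
  run (for_each 0 1 23 observe_body) s0 (4 + size (nbV w) * 11)
    (fun s => [/\ reg s 22 = t + size (nbV w),
       forall v, arr s 13 (code v) = unobserved_sum (fun=> 1) (w |: A) v,
       forall v, arr s 14 (code v) = unobserved_sum (@code V) (w |: A) v,
       forall i, i < t -> arr s 15 i = arr s0 15 i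
     & forall i, i < size (nbV w) -> arr s 15 (t + i) = nth 0 [seq code u | u <- nbV w] i]).
Proof.
move=> rdy e23 e22 wA h13 h14.
apply: (run_for_each (a := w) (l := nbV) (T := 8) (Inv := fun p s =>
  [/\ reg s 22 = t + size p,
      forall v, arr s 13 (code v) = unobserved_sum (fun=> 1) A v - (v \in p),
      forall v, arr s 14 (code v) = unobserved_sum (@code V) A v - (v \in p) * code w,
      forall i, i < t -> arr s 15 i = arr s0 15 i
    & forall i, i < size p -> arr s 15 (t + i) = nth 0 [seq code u | u <- p] i])) => //.
- exact: ready_one.
- exact: ready_nbV.
- by move=> p s s' ea er; rewrite ea er.
- by split=> // [|v|v]; rewrite ?addn0 ?subn0.
- move=> p u q s el f e12 [i22 i13 i14 i15 i15'].
  have up : u \notin p.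
    by have := nbV_uniq w; rewrite el cat_uniq /= => /and3P[_ /norP[]].
  apply: (@run_effect observe_body) => //= _.
  rewrite e12 i22 (f.1 3 isT) (ready_one rdy) (f.1 23 isT) e23.
  split.
  + by rewrite size_rcons; lia.
  + move=> v; rewrite mem_rcons inE (inj_eq (@code_inj V)).
    by case: eqVneq => [->|_] //=; rewrite i13 (negPf up) subn0.
  + move=> v; rewrite mem_rcons inE (inj_eq (@code_inj V)).
    by case: eqVneq => [->|_] //=; rewrite i14 (negPf up) subn0 mul1n.
  + by move=> i it; rewrite i15 //; case: eqP => //; lia.
  + move=> i; rewrite size_rcons ltnS leq_eqVlt map_rcons nth_rcons size_map eqn_add2l.
    case: (ltngtP i (size p)) => //= lt _; exact: i15'.
- move=> s f [i22 i13 i14 i15 i15']; split=> // v.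
    by rewrite i13 (unobserved_sumU1 _ _ wA) muln1 addnK.
  by rewrite i14 (unobserved_sumU1 _ _ wA) addnK.
Qed.

(** A fruitless round costs 9 and pays with the entry it removes. Forcing a node of degree d costs
    17 + 11 d, including the loop test, and pushes d + 1 entries worth 9 each; the removed entry and
    the released 20 (d + 1) cover this. *)
Definition potential A h t := 9 * (t - h) + 20 * \sum_(v | v \notin A) (size (nbV v)).+1.

Lemma potentialU1 A w h t : w \notin A ->
  potential A h t = potential (w |: A) h t + 20 * (size (nbV w)).+1.
Proof.
move=> wA; rewrite /potential (bigD1 w) //= mulnDr addnCA addnC; congr (_ + _ * _ + _).
by apply: eq_bigl => u; rewrite !inE negb_or andbC.
Qed.

(** When [w] is forced, [w] and all its neighbors are pushed. Any other observed node with one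
    unobserved neighbor kept its count, so it was already pending. *)
Lemma run_propagate_body Z A h t s :
  input_ready s -> worklist_state Z A h t s -> h < t ->
  exists T, run propagate_body s T (fun s' => exists A' h' t',
    T.+1 + potential A' h' t' <= potential A h t /\ worklist_state Z A' h' t' s').
Proof.
move=> rs st ht; have [v ev] : exists v, arr s 15 h = code v by apply: (wl_nodes st); lia.
case: (boolP ((v \in A) && (unobserved_sum (fun=> 1) A v == 1))) => [/andP[vA /eqP v1]|nv].
- have [w [wA vw others ew]] := unobserved_one v1.
  exists (3 + (1 + ((2 + ((4 + size (nbV w) * 11) + 2)) + 3)).+1); apply: run_seq.
  apply: (@run_effect (Seq _ (Seq _ _))) => //= f1.
  rewrite (wl_head st) ev (wl_obs st) vA (ready_one rs) in f1 *; set s1 := set_reg _ 15 _ in f1 *.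
  apply: run_if => /=; last by rewrite (ready_zero rs).
  move=> _; apply: run_seq; apply: (@run_effect (Read _ _ _)) => //= f2.
  rewrite (wl_count st) v1 in f2 *; set s2 := set_reg _ 16 _ in f2 *.
  apply: run_when_eq => /=; last by rewrite (ready_one rs).
  move=> _; apply: run_seq; apply: (@run_effect (Seq _ _)) => //= f3.
  rewrite (wl_sum st) ew (ready_one rs) in f3 *; set s3 := set_arr _ _ _ _ in f3 *.
  have rs3 : input_ready s3.
    by apply: ready_frame f3 _ => //; apply: ready_frame f2 _ => //; apply: ready_frame f1 _.
  have obs3 x : arr s3 12 (code x) = (x \in w |: A).
    by rewrite /= (inj_eq (@code_inj V)) !inE; case: eqVneq => //= _; exact: wl_obs st x.
  apply: run_seq; apply: run_weaken
    (run_observe rs3 (A := A) (w := w) (t := t) _ _ _ _ _) (leqnn _) _ => //=.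
  + exact: wl_tail st.
  + exact: wl_count st.
  + exact: wl_sum st.
  move=> s4 [i22 i13 i14 i15 i15'] f4.
  apply: (@run_effect (Seq _ _)) => //=.
  rewrite i22 (f4.1 3 isT) (ready_one rs3) (f4.1 23 isT) /= addn1.
  exists (w |: A), h.+1, (t + size (nbV w)).+1; split.
    by rewrite (potentialU1 _ _ wA) /potential; lia.
  have at_pushed i : i < size (nbV w) -> (t + i == t + size (nbV w)) = false.
    by move=> lt; apply/eqP; lia.
  split=> //=.
  + by rewrite (f4.1 21 isT) /= addn1.
  + by move=> x; rewrite (f4.2 12 isT) obs3.
  + move=> i /andP[hi it]; case: eqP => [_|ne]; first by exists w.
    case: (ltnP i t) => lt; first by rewrite i15 //; apply: (wl_nodes st); lia.
    have lt' : i - t < size (nbV w) by lia.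
    rewrite -(subnKC lt) i15' // (nth_map w) //; by eexists.
  + move=> x; rewrite inE => xA x1.
    case: (eqVneq x w) => [->|xw].
      by exists (t + size (nbV w)); rewrite ?eqxx //; lia.
    case: (boolP (x \in nbV w)) => [xn|xn].
      have lt : index x (nbV w) < size (nbV w) by rewrite index_mem.
      exists (t + index x (nbV w)); first by lia.
      by rewrite at_pushed // i15' // (nth_map w) // nth_index.
    move: xA; rewrite inE (negPf xw) /= => xA.
    have [|i /andP[hi it] ei] := wl_pending st xA.
      by rewrite (unobserved_sumU1 _ _ wA) x1 (negPf xn).
    (* The removed entry stands for [v], which is adjacent to [w], whereas [x] is not. *)
    have ih : i != h.
      apply/eqP => eih; move: xn; rewrite mem_nbV adj_sym.
      by move: ei; rewrite eih ev => /code_inj <-; rewrite vw.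
    exists i; first by move/eqP: ih; lia.
    by rewrite (_ : (i == _) = false) ?i15 //; apply/eqP; lia.
  + exact: subset_trans (wl_dom st) (subsetUr _ _).
  + rewrite subUset sub1set (wl_sound st) andbT.
    apply: (observed_force (v := v)) => // [|u vu uw].
      exact: (subsetP (wl_sound st)).
    exact/(subsetP (wl_sound st))/others.
- have st' s' : arr s' = arr s -> reg s' 21 = h.+1 -> reg s' 22 = t ->
      worklist_state Z A h.+1 t s'.
    case: st => wh wt wo wc ws wn wp wd wso ea e21 e22.
    split=> //; rewrite ?ea //; first by move=> i hi; apply: wn; lia.
    move=> x xA x1.
    have [i hi ei] := wp x xA x1; exists i => //.
    suff: i != h by move/eqP; lia.
    apply: contra nv => /eqP eih; move: ei; rewrite eih ev => /code_inj ->.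
    by rewrite xA x1.
  exists (3 + (1 + (0 + 3)).+1); apply: run_seq.
  have pot : (3 + (1 + (0 + 3)).+1).+1 + potential A h.+1 t <= potential A h t.
    by rewrite /potential; lia.
  apply: (@run_effect (Seq _ (Seq _ _))) => //= f1.
  rewrite (wl_head st) ev (wl_obs st) (ready_one rs) in f1 *; set s1 := set_reg _ 15 _ in f1 *.
  have rs1 : input_ready s1 by apply: ready_frame f1 _.
  apply: run_if => /=; last first.
    move=> _; apply: (run_le (T := 1)) => //; apply: run_skip.
    exists A, h.+1, t; split=> //; apply: st' => //=; rewrite ?addn1 //.
    exact: wl_tail st.
  rewrite (ready_zero rs) => vA; apply: run_seq; apply: (@run_effect (Read _ _ _)) => //= f2.
  apply: run_when_eq => /= [|_].
    rewrite (wl_count st) (ready_one rs) => v1.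
    by move: nv; rewrite v1 eqxx andbT; case: (v \in A) vA.
  exists A, h.+1, t; split=> //; apply: st' => //=; rewrite ?addn1 //.
  exact: wl_tail st.
Qed.

(** Initially all nodes are queued. The initial potential is at most 9 n + 20 (n + arcs), which
    explains the factor 29. Once the worklist is empty no forcing is possible, so the current set is
    closed under Rule 2 and minimality identifies it. *)
Lemma run_propagate s0 Z :
  input_ready s0 ->
  (forall v, arr s0 12 (code v) = (v \in dominated G Z)) ->
  (forall v, [/\ arr s0 13 (code v) = unobserved_sum (fun=> 1) (dominated G Z) v,
           arr s0 14 (code v) = unobserved_sum (@code V) (dominated G Z) v
         & arr s0 15 (code v) = code v]) ->
  run propagate s0 (29 * (#|V| + arcs) + 3)
    (fun s => forall v, arr s 12 (code v) = (v \in observed G Z)).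
Proof.
move=> rdy hd hc.
pose pot := potential (dominated G Z) 0 #|V|.
apply: (run_le (T := 2 + pot.+1)); last first.
  have le : \sum_(v | v \notin dominated G Z) (size (nbV v)).+1 <= #|V| + arcs.
    apply: (@leq_trans (\sum_v (size (nbV v)).+1)).
      by rewrite [X in _ <= X](bigID (fun v => v \notin dominated G Z)) /= leq_addr.
    by under eq_bigr do rewrite -addn1; rewrite big_split /= sum_nat_const muln1 addnC.
  by rewrite /pot /potential; lia.
apply: run_seq; apply: (@run_effect (Seq _ _)) => //= f1.
rewrite (ready_V rdy) (ready_zero rdy) addn0 in f1 *; set s1 := set_reg _ 22 _ in f1 *.
pose Inv phi s := exists A h t, potential A h t <= phi /\ worklist_state Z A h t s.
apply: (run_while (Inv := Inv)).
- exists (dominated G Z), 0, #|V|; split=> //; split=> //=.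
  + by move=> v; have [] := hc v.
  + by move=> v; have [] := hc v.
  + by move=> i /code_onto[v <-]; exists v; have [] := hc v.
  + by move=> v _ _; exists (code v); [exact: code_lt|have [] := hc v].
  + exact: dominated_observed.
- move=> phi s f [A [h [t [le st]]]]; rewrite (wl_head st) (wl_tail st) => ht.
  have rs : input_ready s.
    by apply: ready_frame f _ => //; apply: ready_frame f1 _.
  have [T runT] := run_propagate_body rs st ht; exists T.
  apply: run_weaken runT (leqnn _) _ => s' [A' [h' [t' [le' st']]]] _.
  exists (potential A' h' t'); first by lia.
  by exists A', h', t'.
- move=> phi s f [A [h [t [le st]]]]; rewrite (wl_head st) (wl_tail st) => th v.
  rewrite (wl_obs st); congr (nat_of_bool (_ v)) => {v}.
  suff -> : A = observed G Z by [].
  apply/eqP; rewrite eqEsubset (wl_sound st) /=; apply: observed_min (wl_dom st) _.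
  move=> v w vA vw others; case: (boolP (w \in A)) => // wA.
  have [i] := wl_pending st vA (unobserved_oneE wA vw others); lia.
Qed.

(** * The table of regions and the processing of one tree node *)

Local Notation Y := (Y D r).
Local Notation par := (parent (td_treeP D) r).
Local Notation distr := (dist (td_tree D) r).

Lemma size_bags q : size (bags q) <= #|V|.
Proof.
by have [/card_uniqP <- _] := bagsP q; exact: max_card.
Qed.

Lemma size_nbI q : size (nbI q) <= #|I|.
Proof.
by have [/card_uniqP <- _] := nbIP q; exact: max_card.
Qed.

Lemma mem_bags q v : (v \in bags q) = (v \in bag D q).
Proof. by have [_ ->] := bagsP q. Qed.

Definition add_bag_row := for_each 4 5 7 (Seq (Add 17 8 12) (Write 10 17 r_one)).

Lemma run_add_bag_row s0 q R :
  input_ready s0 -> reg s0 7 = code q ->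
  (forall v, arr s0 10 (reg s0 8 + code v) = (v \in R)) ->
  run add_bag_row s0 (4 + size (bags q) * 5) (fun s =>
    (forall v, arr s 10 (reg s0 8 + code v) = (v \in R :|: bag D q)) /\
    (forall i, (forall v, i <> reg s0 8 + code v) -> arr s 10 i = arr s0 10 i)).
Proof.
move=> rdy e7 hR.
apply: (run_for_each (a := q) (l := bags) (T := 2) (Inv := fun p s =>
    (forall v, arr s 10 (reg s0 8 + code v) = (v \in R) || (v \in p)) /\
    (forall i, (forall v, i <> reg s0 8 + code v) -> arr s 10 i = arr s0 10 i))) => //.
- exact: ready_one.
- exact: ready_bags.
- by move=> p s s' ea er; rewrite ea.
- by split=> // v; rewrite hR orbF.
- move=> p u l s _ f e12 [inv1 inv2]; apply: (@run_effect (Seq _ _)) => //= _.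
  rewrite e12 (f.1 8 isT) (f.1 3 isT) (ready_one rdy); split=> [v|i hi].
    rewrite eqn_add2l code_eq inv1 mem_rcons inE.
    by case: eqVneq => //=; rewrite orbT.
  by rewrite inv2 //; case: eqP => // /hi.
- move=> s f [inv1 inv2]; split=> // v.
  by rewrite inv1 mem_bags in_setU.
Qed.

Definition add_bag_output := for_each 4 5 7 (Write 6 12 r_one).

Lemma run_add_bag_output s0 q S :
  input_ready s0 -> reg s0 7 = code q ->
  (forall v, arr s0 6 (code v) = (v \in S)) ->
  run add_bag_output s0 (4 + size (bags q) * 4)
    (fun s => forall v, arr s 6 (code v) = (v \in S :|: bag D q)).
Proof.
move=> rdy e7 hS.
apply: (run_for_each (a := q) (l := bags) (T := 1) (Inv := fun p s =>
    forall v, arr s 6 (code v) = (v \in S) || (v \in p))) => //.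
- exact: ready_one.
- exact: ready_bags.
- by move=> p s s' ea er; rewrite ea.
- by move=> v; rewrite hS orbF.
- move=> p u l s _ f e12 inv; apply: (@run_effect (Write _ _ _)) => //= _ v.
  rewrite e12 (f.1 3 isT) (ready_one rdy) code_eq inv mem_rcons inE.
  by case: eqVneq => //=; rewrite orbT.
- by move=> s f inv v; rewrite inv mem_bags in_setU.
Qed.

Definition strong_test_body :=
  Seq (Add 17 8 13) (Seq (Read 14 10 17) (Seq (Read 15 12 13)
    (IfLt 15 14 (Const 20 1) skip))).

Lemma run_strong_test s0 R A :
  input_ready s0 -> reg s0 20 = 0 ->
  (forall v, arr s0 10 (reg s0 8 + code v) = (v \in R)) ->
  (forall v, arr s0 12 (code v) = (v \in A)) ->
  run (for_lt 13 0 strong_test_body) s0 (2 + #|V| * 7)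
    (fun s => reg s 20 = ~~ (R \subset A)).
Proof.
move=> rdy e20 hR hA.
apply: (run_le (T := 2 + \sum_(v : V) (5 + 2))); last by rewrite sum_nat_const.
apply: (run_for_all (Inv := fun k s =>
    reg s 20 = has (fun v => (v \in R) && (v \notin A)) (take k (enum V)))) => //.
- exact: ready_one.
- exact: ready_V.
- by rewrite /= take0.
- move=> v s f iv inv; apply: (@run_effect strong_test_body) => //=.
  rewrite iv (f.1 8 isT) (f.2 10 isT) (f.2 12 isT) hR hA take_code has_rcons.
  by case: (v \in R); case: (v \in A) => /= _; rewrite ?inv.
- move=> s f; rewrite take_oversize -?cardE // => ->; congr nat_of_bool.
  apply/hasP/idP => [[v _ /andP[vR vA]]|/subsetPn[v vR vA]].
    by apply/subsetPn; exists v.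
  by exists v; rewrite ?mem_enum ?vR.
Qed.

Definition merge_body :=
  Seq (Add 17 8 13) (Seq (Read 14 10 17)
    (IfLt r_zero 14 (Seq (Add 17 16 13) (Write 10 17 r_one)) skip)).

Lemma run_merge s0 R :
  input_ready s0 ->
  (forall v, arr s0 10 (reg s0 8 + code v) = (v \in R)) ->
  (forall u v, reg s0 8 + code u <> reg s0 16 + code v) ->
  run (for_lt 13 0 merge_body) s0 (2 + #|V| * 7) (fun s =>
    (forall v, arr s 10 (reg s0 16 + code v) =
       if v \in R then 1 else arr s0 10 (reg s0 16 + code v)) /\
    (forall i, (forall v, i <> reg s0 16 + code v) -> arr s 10 i = arr s0 10 i)).
Proof.
move=> rdy hR disj.
apply: (run_le (T := 2 + \sum_(v : V) (5 + 2))); last by rewrite sum_nat_const.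
apply: (run_for_all (Inv := fun k s =>
    (forall v, arr s 10 (reg s0 16 + code v) =
       if (code v < k) && (v \in R) then 1 else arr s0 10 (reg s0 16 + code v)) /\
    (forall i, (forall v, i <> reg s0 16 + code v) -> arr s 10 i = arr s0 10 i))) => //.
- exact: ready_one.
- exact: ready_V.
- move=> v s f iv [inv1 inv2]; apply: (@run_effect merge_body) => //=.
  rewrite iv (f.1 8 isT) (f.1 16 isT) inv2; last exact: disj.
  rewrite hR (f.1 4 isT) (f.1 3 isT) (ready_zero rdy) (ready_one rdy).
  case vR: (v \in R) => /= _; split=> [u|i hi]; rewrite ?code_ltS.
  + by rewrite eqn_add2l code_eq inv1; case: eqVneq => //= ->; rewrite vR.
  + by rewrite inv2 //; case: eqP => // /hi.
  + by rewrite inv1; case: eqVneq => //= ->; rewrite vR !andbF.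
  + exact: inv2.
- move=> s f [inv1 inv2]; split=> // v.
  by rewrite inv1 code_lt.
Qed.

(* Row 0 of the table of regions is a dummy, into which the root is merged. *)
Definition row q := (code q).+1 * #|V|.

Lemma row_inj q q' v v' : row q + code v = row q' + code v' -> q = q'.
Proof.
have lt := code_lt v; have lt' := code_lt v'; move/(congr1 (fun x => x %/ #|V|)).
rewrite /row !divnMDl ?(leq_ltn_trans _ lt) // !divn_small // !addn0 => -[].
exact: code_inj.
Qed.

Lemma row_gt0 q v v' : row q + code v <> code v'.
Proof. by have := code_lt v'; rewrite /row mulSn; lia. Qed.

(** Here [p] lists the tree nodes processed so far. Only rows of unprocessed nodes are described:
    such a row holds the union of the regions of its processed children, and a row is not read again
    after it is merged into that of the parent. *)
Record main_state (p : seq I) s : Prop := MainState {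
  ms_ready : input_ready s;
  ms_output : forall v, arr s 6 (code v) = (v \in foldl (alg_step D r) set0 p);
  ms_dist : forall q, arr s 7 (code q) = (distr q).+1;
  ms_parent : forall q, arr s 8 (code q) = if q == r then 0 else row (par q);
  ms_base : forall q, arr s 9 (code q) = row q;
  ms_rows : forall q v, q \notin p -> arr s 10 (row q + code v) =
    (v \in \bigcup_(c | [&& c \in p, c != r & par c == q]) Y c) }.

Definition process :=
  Seq (Read 8 9 7) (Seq add_bag_row (Seq (for_lt 13 0 seed_body)
  (Seq (for_lt 13 0 dominate_body) (Seq (for_lt 13 0 count_body) (Seq propagate
  (Seq (Const 20 0) (Seq (for_lt 13 0 strong_test_body)
  (Seq (IfLt r_zero 20 add_bag_output skip) (Seq (Read 16 8 7)
  (for_lt 13 0 merge_body)))))))))).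

Lemma Y_rows (p : seq I) q : (forall c, c != r -> par c = q -> c \in p) ->
  (\bigcup_(c | [&& c \in p, c != r & par c == q]) Y c) :|: bag D q = Y q.
Proof.
move=> chp; apply/eqP; rewrite eqEsubset subUset bag_sub_Y andbT; apply/andP; split.
  by apply/bigcupsP => c /and3P[_ cr /eqP <-]; exact: Y_sub_parent.
apply/subsetP => v /Y_child[vq|[c [cr pc vc]]]; rewrite inE ?vq ?orbT //.
by apply/orP; left; apply/bigcupP; exists c; rewrite // chp // cr pc eqxx.
Qed.

(** As all children are done, adding the bag turns the row of [q] into [Y q]. The row is used for
    the test and then merged into the row of the parent, so regions are never recomputed from
    scratch. *)
Lemma run_process p q s0 :
  main_state p s0 -> reg s0 7 = code q -> q \notin p ->
  (forall c, c != r -> par c = q -> c \in p) ->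
  run process s0 (150 * (#|V| + arcs) + 50) (main_state (rcons p q)).
Proof.
move=> ms e7 qp chp; pose S := foldl (alg_step D r) set0 p.
pose Z := S :|: nbr G (Y q).
apply: (run_le (T := 1 + ((4 + size (bags q) * 5) + ((22 * (#|V| + arcs) + 2)
  + ((22 * (#|V| + arcs) + 2) + ((22 * (#|V| + arcs) + 2) + ((29 * (#|V| + arcs) + 3)
  + (1 + ((2 + #|V| * 7) + ((4 + size (bags q) * 4).+1 + (1 + (2 + #|V| * 7)))))))))))); last first.
  by have := size_bags q; lia.
have rdy0 := ms_ready ms.
apply: run_seq; apply: (@run_effect (Read _ _ _)) => //= f1.
rewrite e7 (ms_base ms) in f1 *; set s1 := set_reg _ _ _ in f1 *.
have rdy1 : input_ready s1 by apply: ready_frame f1 _.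
apply: run_seq; apply: run_weaken
  (run_add_bag_row rdy1 (q := q)
     (R := \bigcup_(c | [&& c \in p, c != r & par c == q]) Y c) _ _) (leqnn _) _ => //.
  by move=> v /=; rewrite (ms_rows ms).
rewrite Y_rows // => s2 [hR2 other2] f2; rewrite /= in hR2 other2.
have rdy2 : input_ready s2 by apply: ready_frame f2 _.
have e8_2 : reg s2 8 = row q by rewrite f2.1.
apply: run_seq; apply: run_weaken (run_seed rdy2 (S := S) (R := Y q) _ _) (leqnn _) _.
- by move=> v; rewrite (f2.2 6 isT) /= (ms_output ms).
- by move=> v; rewrite e8_2 hR2.
move=> s3 h3 f3; have rdy3 : input_ready s3 by apply: ready_frame f3 _.
apply: run_seq; apply: run_weaken (run_dominate rdy3 h3) (leqnn _) _ => s4 h4 f4.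
have rdy4 : input_ready s4 by apply: ready_frame f4 _.
apply: run_seq; apply: run_weaken (run_count rdy4 h4) (leqnn _) _ => s5 h5 f5.
have rdy5 : input_ready s5 by apply: ready_frame f5 _.
apply: run_seq; apply: run_weaken (run_propagate rdy5 (Z := Z) _ h5) (leqnn _) _.
  by move=> v; rewrite (f5.2 12 isT) h4.
move=> s6 h6 f6; have rdy6 : input_ready s6 by apply: ready_frame f6 _.
apply: run_seq; apply: (@run_effect (Const _ _)) => //= f7; set s7 := set_reg _ _ _ in f7 *.
have rdy7 : input_ready s7 by apply: ready_frame f7 _.
have regs7 x : x \in [:: 7; 8] -> reg s7 x = reg s1 x.
  by rewrite !inE => /orP[] /eqP -> /=; rewrite f6.1 // f5.1 // f4.1 // f3.1 // f2.1.
have arrs7 a : a \in [:: 6; 7; 8; 9] -> arr s7 a = arr s0 a.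
  rewrite !inE => /or4P[] /eqP -> /=; by rewrite f6.2 // f5.2 // f4.2 // f3.2 // f2.2.
have arr10 : arr s7 10 = arr s2 10 by rewrite /= f6.2 // f5.2 // f4.2 // f3.2.
have e8_7 : reg s7 8 = row q by rewrite regs7.
apply: run_seq; apply: run_weaken
  (run_strong_test rdy7 (R := Y q) (A := observed G Z) _ _ _) (leqnn _) _ => //.
  by move=> v; rewrite e8_7 arr10 hR2.
rewrite -/(strong_region G S (Y q)) => s8 e20 f8.
have rdy8 : input_ready s8 by apply: ready_frame f8 _.
have out8 v : arr s8 6 (code v) = (v \in S) by rewrite f8.2 // arrs7 // (ms_output ms).
apply: run_seq.
apply: (run_weaken (Q := fun s9 => frame (IfLt r_zero 20 add_bag_output skip) s8 s9 /\
    forall v, arr s9 6 (code v) = (v \in alg_step D r S q))) (leqnn _) _.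
  apply: run_frame; apply: run_if; rewrite (ready_zero rdy8) e20 /alg_step => h.
    have -> : strong_region G S (Y q) by case: strong_region h.
    by apply: run_weaken (run_add_bag_output rdy8 (q := q) _ out8) (leqnn _) _ => //;
      rewrite f8.1 // regs7.
  have /negPf -> : ~~ strong_region G S (Y q) by case: strong_region h.
  by apply: (run_le (T := 1)) => //; apply: run_skip => f9; split.
move=> s9 [f9 out9] _.
have rdy9 : input_ready s9 by apply: ready_frame f9 _.
apply: run_seq; apply: (@run_effect (Read _ _ _)) => //= f10.
have e7_9 : reg s9 7 = code q by rewrite f9.1 // f8.1 // regs7.
have e8_9 : reg s9 8 = row q by rewrite f9.1 // f8.1.
have arrs9 a : a \in [:: 7; 8; 9] -> arr s9 a = arr s0 a.
  by rewrite !inE => /or3P[] /eqP ->; rewrite f9.2 // f8.2 // arrs7.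
have arr10_9 : arr s9 10 = arr s2 10 by rewrite f9.2 // f8.2.
rewrite e7_9 arrs9 // (ms_parent ms) in f10 *; set s10 := set_reg _ _ _ in f10 *.
have rdy10 : input_ready s10 by apply: ready_frame f10 _.
have dpar : q != r -> par q != q.
  move=> qr; apply/eqP => e; have := dist_parent (td_treeP D) qr; rewrite e; lia.
apply: run_frame.
apply: run_weaken (run_merge rdy10 (R := Y q) _ _) (leqnn _) _.
- by move=> v /=; rewrite e8_9 arr10_9 hR2.
- move=> u v /=; rewrite e8_9; case: eqVneq => [_|/dpar npar]; first exact: row_gt0.
  by move/row_inj => e; rewrite -e eqxx in npar.
move=> s11 /= [hpar other11] f11.
have notq q' v : q' != q -> arr s2 10 (row q' + code v) = arr s0 10 (row q' + code v).
  by move=> nq; rewrite other2 // => u /row_inj e; rewrite e eqxx in nq.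
split.
- by apply: ready_frame f11 _.
- by move=> v; rewrite (f11.2 6 isT) /= out9 foldl_rcons.
- by move=> q'; rewrite (f11.2 7 isT) /= arrs9 // (ms_dist ms).
- by move=> q'; rewrite (f11.2 8 isT) /= arrs9 // (ms_parent ms).
- by move=> q'; rewrite (f11.2 9 isT) /= arrs9 // (ms_base ms).
move=> q' v; rewrite mem_rcons inE negb_or => /andP[q'q q'p].
have old := ms_rows ms v q'p; rewrite -(notq _ _ q'q) -arr10_9 in old.
case: (boolP ((q != r) && (par q == q'))) => [/andP[qr /eqP pq]|npq].
  have bigE : \bigcup_(c | [&& c \in rcons p q, c != r & par c == q']) Y c =
      (\bigcup_(c | [&& c \in p, c != r & par c == q']) Y c) :|: Y q.
    apply/setP => x; rewrite inE; apply/bigcupP/orP => [[c]|[/bigcupP[c cp xc]|xq]].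
    - rewrite mem_rcons inE => /and3P[/orP[/eqP ->|cp] cr pc] xc; [by right|left].
      by apply/bigcupP; exists c => //; rewrite cp cr pc.
    - by exists c => //; rewrite mem_rcons inE; case/and3P: cp => -> -> ->; rewrite orbT.
    - by exists q => //; rewrite mem_rcons mem_head qr pq eqxx.
  move: hpar => /(_ v); rewrite (negPf qr) pq => ->; rewrite old bigE in_setU.
  by case: (v \in Y q); rewrite ?orbT ?orbF.
rewrite other11 ?old.
  suff -> : \bigcup_(c | [&& c \in rcons p q, c != r & par c == q']) Y c =
      \bigcup_(c | [&& c \in p, c != r & par c == q']) Y c by [].
  apply: eq_bigl => c; rewrite mem_rcons inE.
  by case: (eqVneq c q) => //= ->; rewrite (negPf npq) andbF.
move=> u; case: eqVneq => [_|qr]; first exact: row_gt0.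
by move/row_inj => e; case/negP: npq; rewrite qr -e eqxx.
Qed.

(** Every level scans all tree nodes at cost [b], but the expensive body of cost [B] runs only on
    the nodes of that level. Since [f] lists levels without repetition, each node pays [B] at most
    once. *)
Lemma sum_levels (f : nat -> nat) a b B :
  {in gtn #|I| &, injective f} ->
  \sum_(i < #|I|) (a + \sum_q ((distr q == f i) * B + b)) <=
    #|I| * a + #|I| * (#|I| * b) + #|I| * B.
Proof.
move=> finj; rewrite big_split /= sum_nat_const card_ord -addnA leq_add2l.
under eq_bigr do rewrite big_split /= sum_nat_const.
rewrite big_split /= sum_nat_const card_ord addnC leq_add2l exchange_big /=.
rewrite -[X in _ <= X * _]sum1_card big_distrl /=; apply: leq_sum => q _; rewrite mul1n.
case: (pickP (fun i : 'I_#|I| => distr q == f i)) => [i /eqP e|none]; last first.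
  by rewrite big1 // => i _; rewrite none.
rewrite (bigD1 i) //= e eqxx mul1n big1 ?addn0 // => j ji.
case: eqP => // /finj eij; case/eqP: ji; apply/val_inj/esym/eij; exact: ltn_ord.
Qed.

(** * Row addresses, distances and parents in the tree *)

Definition base_body := Seq (Write 9 7 8) (Add 8 8 0).

Lemma run_base s0 : input_ready s0 -> reg s0 8 = #|V| ->
  run (for_lt 7 1 base_body) s0 (2 + #|I| * 4)
    (fun s => forall q, arr s 9 (code q) = row q).
Proof.
move=> rdy e8.
apply: (run_le (T := 2 + \sum_(q : I) (2 + 2))); last by rewrite sum_nat_const.
apply: (run_for_all (Inv := fun k s => reg s 8 = k.+1 * #|V| /\
    forall q, code q < k -> arr s 9 (code q) = row q)) => //.
- exact: ready_one.
- exact: ready_I.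
- by rewrite /= e8 mul1n.
- move=> q s f iq [inv1 inv2]; apply: (@run_effect base_body) => //= _.
  rewrite iq inv1 (f.1 0 isT) (ready_V rdy); split; first by rewrite [in RHS]mulSn addnC.
  move=> q'; rewrite code_ltS code_eq.
  by case: eqVneq => [->|_] //=; exact: inv2.
- by move=> s f [_ inv] q; apply: inv; exact: code_lt.
Qed.

(** The tree nodes reached by the breadth-first search once all levels below [l] are expanded and,
    on level [l], the nodes of code below [k]. *)
Definition seen l k q := (distr q <= l) || ((distr q == l.+1) && (code (par q) < k)).

Definition bfs_state (P : pred I) s :=
  [/\ forall q, arr s 9 (code q) = row q,
      forall q, arr s 7 (code q) = if P q then (distr q).+1 else 0
    & forall q, arr s 8 (code q) = if P q && (q != r) then row (par q) else 0].

Lemma eq_bfs_state (P P' : pred I) s : P =1 P' -> bfs_state P s -> bfs_state P' s.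
Proof. by move=> e [h1 h2 h3]; split=> // q; rewrite -e. Qed.

Definition scan_body :=
  Seq (Read 17 7 12) (IfLt 17 r_one (Seq (Write 7 12 16) (Write 8 12 15)) skip).

Definition expand := Seq (Read 15 9 7) (for_each 2 3 7 scan_body).

Lemma mem_nbI q (u : I) : (u \in nbI q) = td_tree D q u.
Proof. by have [_ ->] := nbIP q; rewrite inE. Qed.

(** A tree neighbor of [q0] is either its parent, already reached, or a child, reached through no
    other node. Register 16 holds the entry for children: their distance plus one, that is the
    distance of [q0] plus two. *)
Lemma run_expand s0 q0 :
  input_ready s0 -> reg s0 7 = code q0 -> reg s0 16 = (distr q0).+2 ->
  bfs_state (seen (distr q0) (code q0)) s0 ->
  run expand s0 (5 + #|I| * 7) (bfs_state (seen (distr q0) (code q0).+1)).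
Proof.
move=> rdy e7 e16 st; set l := distr q0 in e16 st *.
apply: (run_le (T := 1 + (4 + size (nbI q0) * (4 + 3)))); last first.
  by have := size_nbI q0; lia.
apply: run_seq; apply: (@run_effect (Read _ _ _)) => //= f1.
have [hb _ _] := st; rewrite e7 hb in f1 *; set s1 := set_reg _ _ _ in f1 *.
have rdy1 : input_ready s1 by apply: ready_frame f1 _.
pose seen' (p : seq I) q := seen l (code q0) q ||
  [&& distr q == l.+1, par q == q0 & q \in p].
apply: (run_for_each (a := q0) (l := nbI) (Inv := fun p s => bfs_state (seen' p) s)) => //.
- exact: ready_one.
- exact: ready_nbI.
- by move=> p s s' ea _; rewrite /bfs_state ea.
- by apply: eq_bfs_state st => q; rewrite /seen' in_nil !andbF orbF.
- move=> p u rest s el f e12 [i9 i7 i8].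
  have up : u \notin p.
    by have [un _] := nbIP q0; move: un; rewrite el cat_uniq /= => /and3P[_ /norP[]].
  have q0u : td_tree D q0 u by rewrite -mem_nbI el mem_cat mem_head orbT.
  apply: (@run_effect scan_body) => //=.
  rewrite e12 i7 (f.1 3 isT) (ready_one rdy1) => _.
  have same : seen' p u -> bfs_state (seen' (rcons p u)) s.
    move=> su; apply: (@eq_bfs_state (seen' p)) => // q.
    rewrite /seen' mem_rcons inE; case: (eqVneq q u) => [e|//].
    by move: su; rewrite e /seen'; case: seen => //= /and3P[-> -> ->].
  case: (parent_adj (td_treeP D) r q0u) => -[nr pe].
    have du : distr u = l.+1 by rewrite (dist_parent (td_treeP D) nr) pe.
    have -> : seen' p u = false.
      by rewrite /seen' /seen du ltnn eqxx pe ltnn (negPf up) !andbF.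
    rewrite /= (f.1 16 isT) (f.1 15 isT) /= e16.
    have seenE q : seen' (rcons p u) q = (q == u) || seen' p q.
      rewrite /seen' mem_rcons inE; case: (eqVneq q u) => [->|//].
      by rewrite du pe !eqxx orbT.
    split=> q /=; rewrite ?i9 // code_eq seenE; case: eqVneq => [->|_] //=.
    + by rewrite du.
    + by rewrite nr pe.
  have su : seen' p u.
    rewrite /seen' /seen; apply/orP; left; apply/orP; left.
    by rewrite /l (dist_parent (td_treeP D) nr) pe.
  by rewrite su ltnS ltn0; exact: same.
- move=> s f; apply: eq_bfs_state => q; rewrite /seen' /seen mem_nbI code_ltS.
  case: (leqP (distr q) l) => //= lt; case: (distr q =P l.+1) => //= dq.
  have qr : q != r by rewrite -(dist_eq0 (td_treeP D)) dq.
  have [_ pq] := tree_path_parent (td_treeP D) qr.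
  by case: (eqVneq (par q) q0) pq => [<- ->|_ _] /=; rewrite ?orbT ?orbF.
Qed.

Definition find_dist :=
  Seq (Write 7 2 r_one)
  (for_lt 5 1 (Seq (Seq (Add 6 5 r_one) (Add 16 6 r_one))
    (for_lt 7 1 (Seq (Read 14 7 7) (when_eq 14 6 expand))))).

Lemma run_find_dist s0 :
  input_ready s0 -> (forall q, arr s0 9 (code q) = row q) ->
  (forall q, arr s0 7 (code q) = 0) -> (forall q, arr s0 8 (code q) = 0) ->
  run find_dist s0 (3 + #|I| * 11 + #|I| * (#|I| * 13))
    (fun s => [/\ forall q, arr s 9 (code q) = row q,
      forall q, arr s 7 (code q) = (distr q).+1
    & forall q, arr s 8 (code q) = if q == r then 0 else row (par q)]).
Proof.
move=> rdy h9 h7 h8; pose B := 5 + #|I| * 7.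
apply: (run_le (T := 1 + (2 + \sum_(i < #|I|)
    ((2 + (2 + \sum_q ((1 + ((distr q == i) * B + 3)) + 2))) + 2)))); last first.
  have := @sum_levels id 6 6 B (fun _ _ _ _ => id).
  have -> : \sum_(i < #|I|) (6 + \sum_q ((distr q == id i) * B + 6)) =
     \sum_(i < #|I|) ((2 + (2 + \sum_q ((1 + ((distr q == i) * B + 3)) + 2))) + 2).
    apply: eq_bigr => i _.
    have -> : \sum_q ((1 + ((distr q == i) * B + 3)) + 2) =
        \sum_q ((distr q == i) * B + 6) by apply: eq_bigr => q _; lia.
    by rewrite /=; lia.
  by rewrite /B; lia.
apply: run_seq; apply: (@run_effect (Write _ _ _)) => //= f1.
rewrite (ready_root rdy) (ready_one rdy) in f1 *; set s1 := set_arr _ _ _ _ in f1 *.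
have rdy1 : input_ready s1 by apply: ready_frame f1 _.
apply: (run_for (Inv := fun i s => bfs_state (fun q => distr q <= i) s)
  (T := fun i => 2 + (2 + \sum_q ((1 + ((distr q == i) * B + 3)) + 2)))) => //.
- exact: ready_one.
- exact: ready_I.
- split=> q //=; rewrite leqn0 (dist_eq0 (td_treeP D)) ?code_eq; last by rewrite h8 andbN.
  by case: eqVneq => [->|_] //; rewrite (dist_root (td_treeP D)).
- move=> l s _ f e5 inv; have rs : input_ready s by apply: ready_frame f _.
  apply: run_seq; apply: (@run_effect (Seq _ _)) => //= f2.
  rewrite e5 (ready_one rs) !addn1 in f2 *; set s2 := set_reg _ 16 _ in f2 *.
  have rs2 : input_ready s2 by apply: ready_frame f2 _.
  apply: (run_for_all (Inv := fun k s => bfs_state (seen l k) s)) => //.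
  + exact: ready_one.
  + exact: ready_I.
  + by apply: eq_bfs_state inv => q; rewrite /seen ltn0 andbF orbF.
  + move=> q0 s3 f3 e7 st; have rs3 : input_ready s3 by apply: ready_frame f3 _.
    apply: run_seq; apply: (@run_effect (Read _ _ _)) => //= f4; set s4 := set_reg _ _ _ in f4 *.
    have rs4 : input_ready s4 by apply: ready_frame f4 _.
    have e6 : reg s3 6 = l.+1 by rewrite f3.1.
    have [_ i7 _] := st.
    apply: run_when_eq; rewrite /= e7 i7 e6 => h.
      have dq : distr q0 = l by move: h; case: ifP => // _ [].
      rewrite dq eqxx mul1n; apply: run_weaken (run_expand rs4 (q0 := q0) _ _ _) (leqnn _) _ => //.
      - by rewrite /= f3.1 //= dq.
      - by rewrite dq.
      - by rewrite dq.
    have dq : distr q0 <> l.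
      by move=> dq; apply: h; rewrite /seen dq leqnn.
    move=> _; apply: eq_bfs_state st => q; rewrite /seen code_ltS.
    case: (eqVneq (distr q) l.+1) => //= dq'.
    case: (eqVneq (par q) q0) => //= pq; exfalso; apply: dq.
    have qr : q != r by rewrite -(dist_eq0 (td_treeP D)) dq'.
    by move: dq'; rewrite (dist_parent (td_treeP D) qr) pq => -[].
  + move=> s3 f3 st _; apply: eq_bfs_state st => q.
    by rewrite /seen code_lt andbT [in RHS]leq_eqVlt ltnS orbC.
- move=> s f [i9 i7 i8]; have lt q : distr q <= #|I|.
    exact/ltnW/(dist_lt (td_treeP D)).
  by split=> // q; rewrite ?i7 ?i8 lt //=; case: eqP.
Qed.

(** * The bottom-up main loop *)

Definition level_nodes l := [seq q <- enum I | distr q == l].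

Lemma level_nodesP : level_order D r level_nodes.
Proof.
move=> l; apply: uniq_perm => [||q]; [exact/filter_uniq/enum_uniq|exact: enum_uniq|].
by rewrite mem_filter !mem_enum !inE andbT.
Qed.

(** The processing order after [i] rounds. The loop starts at level [#|I| - 1], an upper bound on
    the depth, which spares computing the depth. *)
Definition processed i := flatten [seq level_nodes l | l <- rev (iota (#|I| - i) i)].

Lemma processedS i : i < #|I| ->
  processed i.+1 = processed i ++ level_nodes (#|I| - i.+1).
Proof.
move=> lt; rewrite /processed /= rev_cons map_rcons flatten_rcons.
by rewrite -(subnSK lt).
Qed.

Lemma mem_processed i q : i <= #|I| -> (q \in processed i) = (#|I| - i <= distr q).
Proof.
move=> le; apply/flatten_mapP/idP => [[l]|dq].
  by rewrite mem_rev mem_iota mem_filter => /andP[h _] /andP[/eqP ->].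
exists (distr q); last by rewrite mem_filter eqxx mem_enum.
rewrite mem_rev mem_iota dq subnK //; exact: (dist_lt (td_treeP D)).
Qed.

(** The additional rounds concern levels beyond the depth, which are empty. *)
Lemma algorithm_processed :
  algorithm D r level_nodes = foldl (alg_step D r) set0 (processed #|I|).
Proof.
rewrite /algorithm /processed subnn; set d := depth _ _.
have dI : d.+1 <= #|I|.
  rewrite /d /depth; have : 0 < #|I| by apply/card_gt0P; exists r.
  case: #|I| (dist_lt (td_treeP D) r) => // m lt _.
  by rewrite ltnS; apply/bigmax_leqP => q _; have := lt q.
have fold_flatten S ls : foldl (fun S l => foldl (alg_step D r) S (level_nodes l)) S ls =
    foldl (alg_step D r) S (flatten [seq level_nodes l | l <- ls]).
  by elim: ls S => //= l ls IH S; rewrite IH foldl_cat.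
rewrite fold_flatten -(subnKC dI) iotaD rev_cat map_cat flatten_cat foldl_cat.
suff -> : flatten [seq level_nodes l | l <- rev (iota (0 + d.+1) (#|I| - d.+1))] = [::] by [].
apply/eqP; rewrite -size_eq0 -leqn0 leqNgt -has_predT; apply/negP => /hasP[q].
case/flatten_mapP => l; rewrite mem_rev mem_iota mem_filter => /andP[ge _] /andP[/eqP dq _] _.
have := @leq_bigmax _ distr q; rewrite -/(depth _ _) -/d; lia.
Qed.

Lemma main_state_set_reg p s x k :
  x \notin iota 0 5 -> main_state p s -> main_state p (set_reg s x k).
Proof.
move=> x5 [rdy ? ? ? ? ?]; split=> //; have [h0 h1 h2 h3 h4 hV hI hB] := rdy.
have ne y : y < 5 -> (y == x) = false.
  by move=> y5; apply/negP => /eqP e; move: x5; rewrite -e mem_iota y5.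
by split=> //=; rewrite ne.
Qed.

(** Register 6 is [#|I|] minus the round, hence the level plus one, matching the shifted distances
    in array 7. *)
Definition main_loop :=
  for_lt 5 1 (Seq (Defs.Sub 6 1 5)
    (for_lt 7 1 (Seq (Read 14 7 7) (when_eq 14 6 process)))).

Lemma run_main_loop s0 : main_state [::] s0 ->
  run main_loop s0 (2 + #|I| * 5 + #|I| * (#|I| * 6) + #|I| * (150 * (#|V| + arcs) + 50))
    (main_state (processed #|I|)).
Proof.
move=> ms0; have rdy := ms_ready ms0; pose B := 150 * (#|V| + arcs) + 50.
apply: (run_le (T := 2 + \sum_(i < #|I|)
    ((1 + (2 + \sum_q ((1 + ((distr q == #|I| - i.+1) * B + 3)) + 2))) + 2))); last first.
  have inj : {in gtn #|I| &, injective (fun i => #|I| - i.+1)}.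
    by move=> i j; rewrite !inE; lia.
  have := sum_levels 5 6 B inj.
  have -> : \sum_(i < #|I|) (5 + \sum_q ((distr q == #|I| - i.+1) * B + 6)) =
     \sum_(i < #|I|) ((1 + (2 + \sum_q ((1 + ((distr q == #|I| - i.+1) * B + 3)) + 2))) + 2).
    apply: eq_bigr => i _.
    have -> : \sum_q ((1 + ((distr q == #|I| - i.+1) * B + 3)) + 2) =
        \sum_q ((distr q == #|I| - i.+1) * B + 6) by apply: eq_bigr => q _; lia.
    by rewrite /=; lia.
  by rewrite /B; lia.
apply: (run_for (Inv := fun i s => main_state (processed i) s)
  (T := fun i => 1 + (2 + \sum_q ((1 + ((distr q == #|I| - i.+1) * B + 3)) + 2)))) => //.
- exact: ready_one.
- exact: ready_I.
- exact: main_state_set_reg.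
- move=> i s iI f e5 ms; set l := #|I| - i.+1.
  apply: run_seq; apply: (@run_effect (Defs.Sub _ _ _)) => //= f2.
  rewrite e5 (ready_I (ms_ready ms)) in f2 *; set s2 := set_reg _ _ _ in f2 *.
  have ms2 : main_state (processed i) s2 by exact: main_state_set_reg.
  have lS : l.+1 = #|I| - i by rewrite /l subnSK.
  apply: (run_for_all (Inv := fun k s => main_state
      (processed i ++ [seq q <- take k (enum I) | distr q == l]) s)) => //.
  + exact/ready_one/ms_ready/ms2.
  + exact/ready_I/ms_ready/ms2.
  + by rewrite take0 cats0; exact: main_state_set_reg.
  + move=> q s3 f3 e7 ms3.
    apply: run_seq; apply: (@run_effect (Read _ _ _)) => //= f4; set s4 := set_reg _ _ _ in f4 *.
    have ms4 : main_state (processed i ++ [seq q <- take (code q) (enum I) | distr q == l]) s4.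
      exact: main_state_set_reg.
    have e6 : reg s3 6 = l.+1 by rewrite f3.1.
    rewrite take_code filter_rcons.
    apply: run_when_eq; rewrite /= e7 (ms_dist ms3) e6 => h.
      have dq : distr q = l by case: h.
      rewrite dq eqxx mul1n -rcons_cat.
      apply: run_weaken (run_process (q := q) ms4 _ _ _) (leqnn _) _ => //.
      - rewrite mem_cat mem_processed ?(ltnW iI) // dq -lS ltnn /= mem_filter negb_and.
        apply/orP; right; have := enum_uniq I; rewrite -{1}(cat_take_drop (code q).+1 (enum I)).
        by rewrite take_code cat_uniq rcons_uniq => /and3P[/andP[]].
      - move=> c cr pc; rewrite mem_cat mem_processed ?(ltnW iI) //.
        by rewrite (dist_parent (td_treeP D) cr) pc dq lS leqnn.
      - by move=> s5 ms5 _; exact: main_state_set_reg.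
    have /negPf -> : distr q != l by apply/eqP => e; apply: h; rewrite e.
    by move=> _; apply: main_state_set_reg => //; exact: main_state_set_reg.
  + move=> s3 f3; rewrite take_oversize -?cardE // => ms3 _; apply: main_state_set_reg => //.
    by rewrite processedS.
Qed.

(** * The complete program and its running time *)

Definition program :=
  Seq (Seq (Const 3 1) (Add 8 0 r_zero))
  (Seq (for_lt 7 1 base_body) (Seq find_dist main_loop)).

Lemma run_program :
  run program (input_memory nbV nbI bags r)
    (9 + #|I| * 20 + #|I| * (#|I| * 19) + #|I| * (150 * (#|V| + arcs) + 50))
    (fun s => outputs s (algorithm D r level_nodes)).
Proof.
set s0 := input_memory _ _ _ _; pose n := #|V|; pose m := #|I|.
apply: (run_le (T := 2 + ((2 + m * 4) + ((3 + m * 11 + m * (m * 13)) +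
   (2 + m * 5 + m * (m * 6) + m * (150 * (n + arcs) + 50)))))); last by rewrite -/n -/m; lia.
apply: run_seq; apply: (@run_effect (Seq _ _)) => //= f1; set s1 := set_reg _ 8 _ in f1 *.
have rdy1 : input_ready s1.
  split=> //.
  - by apply: lists_at_input.
  - by apply: lists_at_input.
  - by apply: lists_at_input.
apply: run_seq; apply: run_weaken (run_base rdy1 _) (leqnn _) _; first by rewrite /= addn0.
move=> s2 h9 f2; have rdy2 : input_ready s2 by apply: ready_frame f2 _.
apply: run_seq; apply: run_weaken (run_find_dist rdy2 h9 _ _) (leqnn _) _.
- by move=> q; rewrite f2.2.
- by move=> q; rewrite f2.2.
move=> s3 [i9 i7 i8] f3; have rdy3 : input_ready s3 by apply: ready_frame f3 _.
have ms : main_state [::] s3.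
  split=> //.
  - by move=> v; rewrite f3.2 // f2.2 // inE.
  - by move=> q v _; rewrite f3.2 // f2.2 // big_pred0 ?inE.
apply: run_weaken (run_main_loop ms) (leqnn _) _ => s4 ms4 v.
by rewrite algorithm_processed -(ms_output ms4).
Qed.

(** Arcs are grouped by their unordered pair of ends; a group contains at most the two orientations
    of one edge. *)
Lemma arcs_le : arcs <= 2 * #|edges G|.
Proof.
pose A := [set uv : V * V | G uv.1 uv.2].
have -> : arcs = #|A|.
  rewrite -sum1_card (eq_bigl (fun uv => G uv.1 uv.2)); last by move=> uv; rewrite inE.
  rewrite -(pair_big_dep xpredT (fun u v => G u v) (fun _ _ => 1)) /=.
  apply: eq_bigr => v _; rewrite sum1_card; have [/card_uniqP <- _] := nbVP v.
  by apply: eq_card => u; rewrite mem_nbV.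
pose ends (uv : V * V) := [set uv.1; uv.2].
rewrite -sum1_card (partition_big_imset ends) /=.
have -> : edges G = ends @: A.
  by apply/setP => e; apply/imsetP/imsetP => -[uv h ->]; exists uv; move: h; rewrite ?inE.
rewrite mulnC -sum_nat_const; apply: leq_sum => _ /imsetP[[u v] _ ->].
rewrite sum1_card; apply: (@leq_trans #|[set (u, v); (v, u)]|); last first.
  by rewrite cards2; case: eqP.
apply/subset_leq_card/subsetP => -[x y]; rewrite !inE => /andP[xy /eqP e].
have nxy : x != y by apply/eqP => exy; move: xy; rewrite exy inE /= adj_irr.
have : x \in ends (u, v) by rewrite -e !inE eqxx.
have : y \in ends (u, v) by rewrite -e !inE eqxx orbT.
rewrite !inE !xpair_eqE /= => /orP[] /eqP ey /orP[] /eqP ex; move: nxy;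
  by rewrite ex ey ?eqxx ?orbT.
Qed.

End Blocks.

Theorem theorem3 :
  (forall (V : finType) (G : sgraph V) (I : finType) (D : tree_decomp G I)
          (k : nat) (r : I) (ord : nat -> seq I),
     width D = k -> level_order D r ord ->
     power_dominates G (algorithm D r ord) /\
     #|algorithm D r ord| <= (k + 1) * Opt G)
  /\
  (exists prog : cmd, forall c : nat, exists C : nat,
     forall (V : finType) (G : sgraph V) (I : finType) (D : tree_decomp G I)
            (r : I)
            (nbV : V -> seq V) (nbI : I -> seq I) (bags : I -> seq V),
     lists_of (neighbors G) nbV ->
     lists_of (neighbors (td_tree D)) nbI ->
     lists_of (bag D) bags ->
     #|I| <= c * #|V| ->
     #|V| <= c * #|edges G| ->
     exists (t : nat) (s : memory) (ord : nat -> seq I),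
       exec prog (input_memory nbV nbI bags r) t s /\
       t <= C * (#|V| * #|edges G|) /\
       level_order D r ord /\
       outputs s (algorithm D r ord)).
Proof.
split=> [V G I D k r ord <-|]; first exact: algorithm_approximates.
exists program => c.
(* The summands bound those of [run_program] in the same order: with n nodes, e edges, m tree nodes
   and a arcs, m is at most c n e, m^2 at most c^3 n e, m n at most c^2 n e, and m a at most 2 c n
   e. *)
exists (9 + c * 20 + c * c * c * 19 + c * (150 * (c + 2) + 50)).
move=> V G I D r nbV nbI bags nbVP nbIP bagsP leI leV.
have [t [s [run_t le_t out]]] := run_program r nbVP nbIP bagsP.
exists t, s, (level_nodes D r); do !split=> //; last exact: level_nodesP.
apply: leq_trans le_t _; have := arcs_le nbVP; set a := arcs nbV => le_a.
have : 0 < #|I| by apply/card_gt0P; exists r.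
move: leI leV le_a; set n := #|V|; set m := #|I|; set e := #|edges G|.
move=> leI leV le_a m_gt0.
(* The tree contains the root, so the size hypotheses force [n] and [e] to be positive; this lets n
   e absorb constants and terms linear in m. *)
have n_gt0 : 0 < n by case: (n) leI; lia.
have e_gt0 : 0 < e by case: (e) leV; lia.
have le1 : 1 <= n * e by rewrite muln_gt0 n_gt0.
have le_m : m <= c * (n * e) by nia.
have le_mn : m * n <= c * c * (n * e) by nia.
have le_ma : m * a <= 2 * c * (n * e) by nia.
have le_mm : m * m <= c * c * c * (n * e).
  (* One factor m is bounded by c n, the other by c n and then by c times c e. *)
  apply: (@leq_trans ((c * n) * (c * (c * e)))); last by nia.
  by apply: leq_mul => //; apply: leq_trans leI _; rewrite leq_mul2l leV orbT.
nia.
Qed.
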